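(* Let $n\ge 1$ be an integer. There exists a constant $C>0$ depending only on $n$ (and not on $s$ or $p$) such that for every $p\in[1,+\infty]$, every $s\in[0,1]$, every $u\in W^{s,p}(\mathbb{R}^n)$ and every $y\in\mathbb{R}^n$, $$\|u(\cdot+y)-u\|_{L^p(\mathbb{R}^n)}\le C\,[u]_{W^{s,p}(\mathbb{R}^n)}\,|y|^s .$$ An admissible value is $C=4n(n+1)e^{\frac{1}{e\,\omega_n n}}$.
   Context: $\omega_n$ denotes the volume of the unit ball of $\mathbb{R}^n$. For $s\in(0,1)$ and $p\in[1,\infty)$ the normalised Gagliardo seminorm is $$[u]_{W^{s,p}(\mathbb{R}^n)}=\left(s(1-s)\int_{\mathbb{R}^n}\int_{\mathbb{R}^n}\frac{|u(x)-u(y)|^p}{|x-y|^{n+sp}}\,dx\,dy\right)^{1/p}.$$ In the limit cases: $[u]_{W^{0,p}(\mathbb{R}^n)}=\|u\|_{L^p(\mathbb{R}^n)}$ and $[u]_{W^{1,p}(\mathbb{R}^n)}=\|\nabla u\|_{L^p(\mathbb{R}^n)}$ (weak gradient) for $p\in[1,\infty]$, and $[u]_{W^{s,\infty}(\mathbb{R}^n)}=\operatorname{ess\,sup}_{x,y\in\mathbb{R}^n}\frac{|u(x)-u(y)|}{|x-y|^s}$ for $s\in(0,1)$. The space is $W^{s,p}(\mathbb{R}^n)=\{u\in L^p(\mathbb{R}^n): [u]_{W^{s,p}(\mathbb{R}^n)}<+\infty\}$; thus $W^{0,p}=L^p$ and $W^{1,p}$ is the usual Sobolev space. *)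

(* Defs.v *)
From HB Require Import structures.
From mathcomp Require Import all_boot all_order all_algebra.
From mathcomp Require Import all_classical all_reals all_analysis.
From mathcomp Require Import ess_sup_inf.

Set Implicit Arguments.
Unset Strict Implicit.
Unset Printing Implicit Defensive.

Import Order.TTheory GRing.Theory Num.Def Num.Theory.
Import numFieldNormedType.Exports.

Local Open Scope classical_set_scope.
Local Open Scope ring_scope.

(* The sigma-algebra on 'rV[R]_n generated by the coordinate maps, i.e. the
   Borel sigma-algebra of R^n. *)
Definition rV_display : measure_display. Proof. exact. Qed.

Section measurable_rV.
Context {R : realType} (n : nat).

Let coords : 'I_n -> 'rV[R]_n -> R := fun i x => x ord0 i.

Let rV_set0 : g_sigma_preimage coords set0.
Proof. exact: sigma_algebra0. Qed.

Let rV_setC A : g_sigma_preimage coords A -> g_sigma_preimage coords (~` A).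
Proof. exact: sigma_algebraC. Qed.

Let rV_bigcup (F : (set 'rV[R]_n)^nat) :
  (forall i, g_sigma_preimage coords (F i)) ->
  g_sigma_preimage coords (\bigcup_i (F i)).
Proof. exact: sigma_algebra_bigcup. Qed.

HB.instance Definition _ := @isMeasurable.Build rV_display
  'rV[R]_n (g_sigma_preimage coords) rV_set0 rV_setC rV_bigcup.

End measurable_rV.



Section lebesgue_rV.
Context {R : realType}.

Lemma measurable_coord_rV n (i : 'I_n) :
  measurable_fun setT (fun x : 'rV[R]_n => x ord0 i).
Proof.
move=> _ Y mY; rewrite setTI; apply: sub_sigma_algebra => /=.
rewrite -bigcup_seq/=; exists i => /=; first by rewrite mem_index_enum.
by exists Y => //; rewrite setTI.
Qed.

Lemma measurable_fun_rVP d (T : measurableType d) n (f : T -> 'rV[R]_n) :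
  (forall i, measurable_fun setT (fun t => f t ord0 i)) -> measurable_fun setT f.
Proof.
move=> mf _ A; rewrite setTI.
pose G : set (set 'rV[R]_n) := [set B | measurable (f @^-1` B)].
suff : measurable `<=` G by apply.
apply: smallest_sub.
  split => [|B GB|F GF]; rewrite /G/=.
  - by rewrite preimage_set0.
  - by rewrite setTD preimage_setC; exact: measurableC.
  - by rewrite preimage_bigcup; by apply: bigcup_measurable => k _; exact: GF.
move=> B; rewrite -bigcup_seq => -[i _ [C mC <-]].
rewrite /G/= setTI -comp_preimage.
by have := mf i measurableT C mC; rewrite setTI.
Qed.

Definition cons_rV n (z : 'rV[R]_n * measurableTypeR R) : 'rV[R]_n.+1 :=
  row_mx (z.2)%:M z.1.

Lemma cons_rV0 n (z : 'rV[R]_n * measurableTypeR R) :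
  cons_rV z ord0 ord0 = z.2.
Proof.
by have := row_mxEl (z.2)%:M z.1 ord0 ord0; rewrite [RHS]mxE eqxx mulr1n => <-; congr (row_mx _ _ _ _); exact: val_inj.
Qed.

Lemma cons_rVS n (z : 'rV[R]_n * measurableTypeR R) (i : 'I_n) :
  cons_rV z ord0 (lift ord0 i) = z.1 ord0 i.
Proof.
by have := row_mxEr (z.2)%:M z.1 ord0 i => <-; congr (row_mx _ _ _ _); exact: val_inj.
Qed.

Lemma measurable_cons_rV n : measurable_fun setT (@cons_rV n).
Proof.
apply: measurable_fun_rVP => i; case: (unliftP ord0 i) => [j ->|->].
  under eq_fun do rewrite cons_rVS.
  exact: (measurableT_comp (measurable_coord_rV j)).
under eq_fun do rewrite cons_rV0.
exact: measurable_snd.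
Qed.

(* Lebesgue measure on R^n: the n-fold product of the Lebesgue measure on R
   (see lebesgue_rV_box below). *)
Fixpoint lebesgue_rV n : set 'rV[R]_n -> \bar R :=
  if n is n'.+1
  then pushforward (@lebesgue_rV n' \x lebesgue_measure)%E (@cons_rV n')
  else dirac (0 : 'rV[R]_0).

Let lebesgue_rV_measureE n :
  exists m : {measure set 'rV[R]_n -> \bar R}, @lebesgue_rV n = m.
Proof.
elim: n => [|n [m mE]]; first by exists (dirac (0 : 'rV[R]_0)).
pose m' : {measure set ('rV[R]_n * measurableTypeR R) -> \bar R} :=
  (m \x lebesgue_measure)%E.
unshelve eexists (pushforward m' (@cons_rV n)); first exact: measurable_cons_rV.
by rewrite /= mE.
Qed.

Let lebesgue_rV0 n : @lebesgue_rV n set0 = 0%E.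
Proof. by have [m ->] := lebesgue_rV_measureE n; exact: measure0. Qed.

Let lebesgue_rV_ge0 n A : (0 <= @lebesgue_rV n A)%E.
Proof. by have [m ->] := lebesgue_rV_measureE n; exact: measure_ge0. Qed.

Let lebesgue_rV_semi_sigma_additive n : semi_sigma_additive (@lebesgue_rV n).
Proof.
have [m ->] := lebesgue_rV_measureE n; exact: measure_semi_sigma_additive.
Qed.

HB.instance Definition _ n := isMeasure.Build _ _ _ (@lebesgue_rV n)
  (@lebesgue_rV0 n) (@lebesgue_rV_ge0 n) (@lebesgue_rV_semi_sigma_additive n).

Lemma measurable_box_rV n (A : 'I_n -> set R) :
  (forall i, measurable (A i)) ->
  measurable [set x : 'rV[R]_n | forall i, A i (x ord0 i)].
Proof.
move=> mA; rewrite (_ : mkset _ =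
    \bigcap_(i : 'I_n) ((fun x : 'rV[R]_n => x ord0 i) @^-1` A i)).
  apply: fin_bigcap_measurable => [|i _]; first exact: finite_finset.
  by have := measurable_coord_rV i measurableT (mA i); rewrite setTI.
by apply/seteqP; split=> [x xA i _|x xA i]; exact: xA.
Qed.

Lemma lebesgue_rV_box n (A : 'I_n -> set R) :
  (forall i, measurable (A i)) ->
  lebesgue_rV [set x : 'rV[R]_n | forall i, A i (x ord0 i)] =
  (\prod_(i < n) lebesgue_measure (A i))%E.
Proof.
elim: n A => [|n IHn] A mA.
  by rewrite big_ord0 /= diracE mem_set//= => -[].
rewrite big_ord_recl /= /pushforward (_ : _ @^-1` _ =
    [set x : 'rV[R]_n | forall i, A (lift ord0 i) (x ord0 i)] `*` A ord0).
  have mA' : measurable [set x : 'rV[R]_n | forall i, A (lift ord0 i) (x ord0 i)].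
    by apply: (@measurable_box_rV n (fun i => A (lift ord0 i))) => i; exact: mA.
  rewrite product_measure1E//; last exact: mA.
  rewrite muleC; congr (_ * _)%E.
  by apply: (IHn (fun i => A (lift ord0 i))) => i; exact: mA.
apply/seteqP; split=> [z zA|z [zA zA0] i]/=.
  by split=> [i|]; [rewrite -cons_rVS|rewrite -cons_rV0]; exact: zA.
by case: (unliftP ord0 i) => [j ->|->]; rewrite ?cons_rVS ?cons_rV0.
Qed.

Let sigma_finite_lebesgue_rV n : sigma_finite setT (@lebesgue_rV n).
Proof.
pose I (k : nat) (_ : 'I_n) : set R := `[- k%:R, k%:R]%classic.
have mI k i : measurable (I k i) by exact: measurable_itv.
exists (fun k => [set x : 'rV[R]_n | forall i, I k i (x ord0 i)]) => [|k].
  apply/esym; rewrite -subTset => x _; exists (Num.bound `|x|) => // i.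
  rewrite /I /= in_itv/= -ler_norml (le_trans _ (ltW (archi_boundP _)))//.
  rewrite [leRHS]/normr/= mx_normrE.
  exact: (le_bigmax _ (fun ij => `|x ij.1 ij.2|) (ord0, i)).
split; first exact: measurable_box_rV.
rewrite lebesgue_rV_box// -ge0_fin_numE; last by apply: prode_ge0.
apply: prode_fin_num => i _; rewrite lebesgue_measure_itv/=.
by case: ifPn.
Qed.

HB.instance Definition _ n := Measure_isSigmaFinite.Build _ _ _
  (@lebesgue_rV n) (@sigma_finite_lebesgue_rV n).

End lebesgue_rV.
Arguments lebesgue_rV {R n}.

Section sobolev.
Context {R : realType} {n : nat}.
Implicit Types (x y : 'rV[R]_n) (p : \bar R) (s : R) (u phi : 'rV[R]_n -> R).

Local Notation mu := (@lebesgue_rV R n).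

(* The norm `|x| that the library puts on 'rV[R]_n is the sup norm. *)
Definition eucl_norm x : R := Num.sqrt (\sum_(i < n) x ord0 i ^+ 2).

Definition omega : R := fine (mu [set x | eucl_norm x <= 1]).

Definition base_vec (i : 'I_n) : 'rV[R]_n := delta_mx ord0 i.

Definition iter_partial (l : seq 'I_n) phi : 'rV[R]_n -> R :=
  foldr (fun i f => 'D_(base_vec i) f) phi l.

(* C^oo: all iterated partial derivatives exist and are continuous. The
   derivability clause is needed since 'D_v f is a total operator. *)
Definition smooth phi := forall l : seq 'I_n,
  continuous (iter_partial l phi) /\
  forall x i, derivable (iter_partial l phi) x (base_vec i).

Definition test_function phi :=
  smooth phi /\ compact (closure [set x | phi x != 0]).

Definition locally_integrable_rV u := measurable_fun setT u /\
  forall K, compact K -> (\int[mu]_(x in K) `|u x|%:E < +oo)%E.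

Definition is_weak_gradient u (g : 'rV[R]_n -> 'rV[R]_n) := forall i,
  locally_integrable_rV (fun x => g x ord0 i) /\
  forall phi, test_function phi ->
    (\int[mu]_x (u x * 'D_(base_vec i) phi x)%:E =
     - \int[mu]_x (g x ord0 i * phi x)%:E)%E.

(* A weak gradient is unique up to a null set, so any choice gives the same
   norm below. *)
Definition weak_gradient u : 'rV[R]_n -> 'rV[R]_n :=
  xget (cst 0) [set g | is_weak_gradient u g].

(* +oo when u has no weak gradient, which excludes u from W^{1,p}. *)
Definition gradient_norm p u : \bar R :=
  if `[< exists g, is_weak_gradient u g >]
  then ('N[mu]_p[(fun x => (eucl_norm (weak_gradient u x))%:E)])%E
  else +oo%E.

(* On the diagonal the quotient is 0, since 0^-1 = 0; the diagonal is a null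
   set. The same holds in hoelder_esssup. *)
Definition gagliardo s (p : R) u : \bar R :=
  (((s * (1 - s))%:E *
    \int[mu]_y \int[mu]_x
      ((`|u x - u y| `^ p) / (eucl_norm (x - y) `^ (n%:R + s * p)))%:E)
   `^ p^-1)%E.

Definition hoelder_esssup s u : \bar R :=
  ess_sup (mu \x mu)%E
    (fun z => (`|u z.1 - u z.2| / (eucl_norm (z.1 - z.2) `^ s))%:E).

(* [u]_{W^{s,p}(R^n)}; only meaningful for 0 <= s <= 1 and 1 <= p <= +oo. *)
Definition sobolev_seminorm s p u : \bar R :=
  if s == 0 then ('N[mu]_p[EFin \o u])%E
  else if s == 1 then gradient_norm p u
  else match p with
       | r%:E => gagliardo s r u
       | +oo%E => hoelder_esssup s u
       | -oo%E => +oo%E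
       end.

Definition sobolev s p : set ('rV[R]_n -> R) :=
  [set u | u \in Lfun mu p /\ (sobolev_seminorm s p u < +oo)%E].

(* powR gives 0 `^ 0 = 1. *)
Definition translation_estimate (C : R) :=
  forall p s u y, (1 <= p)%E -> 0 <= s <= 1 -> sobolev s p u ->
  ('N[mu]_p[(fun x => (u (x + y) - u x)%:E)] <=
   C%:E * sobolev_seminorm s p u * (eucl_norm y `^ s)%:E)%E.

End sobolev.
Arguments omega : clear implicits.
Arguments translation_estimate : clear implicits.

(* Main.v *)
From HB Require Import structures.
Require Import Defs.
From mathcomp Require Import all_boot all_order all_algebra.
From mathcomp Require Import all_classical all_reals all_analysis.
From mathcomp Require Import measurable_realfun ess_sup_inf charge ring lra.
Set Implicit Arguments.
Unset Strict Implicit.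
Unset Printing Implicit Defensive.
Import Order.TTheory GRing.Theory Num.Def Num.Theory.
Import numFieldNormedType.Exports.
Local Open Scope classical_set_scope.
Local Open Scope ring_scope.

(** Write Omega(h) for the L^p norm of u(. + h) - u. Minkowski's inequality and
translation invariance make Omega subadditive ([modulusD]), so that
Omega(m h) <= m Omega(h). The estimate then splits along the definition of the
seminorm.

For s = 0 it is the triangle inequality, with constant 2 ([modulus_le2]).

For 0 < s < 1 and p < oo, the substitution x = y + h turns the double integral
into the integral of Omega(h)^p |h|^(-n-sp) ([gagliardo_integralE]), and
Omega(y) has to be compared with this weighted mean. Averaging
Omega(y) <= Omega(h) + Omega(h - y) over h bounds Omega(y)^p by 4^p times
the mean of Omega^p over the ball of centre 0 and radius t, as soon as
n |y| <= t ([ball_average_small]). For smaller t, y is cut into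
m equal steps; as m min(t/|y|, 1) <= n + 1, for every t > 0
<<
  t^n omega min(t/|y|, 1)^p Omega(y)^p <= (4 (n + 1))^p \int_(|h| <= t) Omega(h)^p dh
>>
([modulus_pow_ball]). Multiply by t^(-n-sp-1) and integrate over t > 0. On the
left, the integral of t^(-sp-1) min(t/|y|, 1)^p is |y|^(-sp) / (p s (1 - s))
([integral_min_powR]): this is exactly the normalisation of the seminorm, and the
reason why the constant does not depend on s. On the right, the layer cake formula
gives back the Gagliardo integral ([layer_cake_le]). After a p-th root there remains
the factor (p / (n omega))^(1/p), bounded for all p by exp(1 / (e n omega)) because
ln z <= z / e ([powR_inv_le_exp]).

For 0 < s < 1 and p = oo, the Hoelder bound holds for almost every pair, so x and
x + y are compared through a third point at distance at most |y| from x
([modulus_hoelder]).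

For s = 1, it suffices to move along one coordinate axis at a time, which costs the
factor n ([modulus_gradient]). For w along an axis and G the weak derivative of u in
the direction w,
<<
  u(x + w) - u(x) = \int_0^1 G(x + t w) dt    for almost every x
>>
([shift_identity]), and Jensen's inequality followed by Tonelli bounds Omega(w) by
the norm of G. The identity is proved against smooth bumps, by moving the
increment onto the bump and applying Fubini on both sides of the definition of the
weak derivative ([shift_identity_bump]). The bumps come from the algebra
generated by the functions P(1/t) exp(-1/t) of affine coordinates ([flat_alg]),
which is closed under partial derivatives; they converge boundedly to indicators of
boxes, which is enough for the fundamental lemma ([ae_eq_bump]). *)

(** * Lebesgue measure on boxes and Euclidean balls *)

Section boxes.
Context {R : realType}.

Definition open_box n (a b : 'I_n -> R) : set 'rV[R]_n :=
  [set x | forall i, `]a i, b i[%classic (x ord0 i)].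

Lemma measurable_open_box n (a b : 'I_n -> R) : measurable (open_box a b).
Proof.
by apply: (@measurable_box_rV R n (fun i => `]a i, b i[%classic)) => i; exact: measurable_itv.
Qed.

Lemma coord_lt_bound n (x : 'rV[R]_n) j : `|x ord0 j| < (Num.bound `|x|)%:R.
Proof.
rewrite (le_lt_trans _ (archi_boundP _))// [leRHS]/normr/= mx_normrE.
exact: (le_bigmax _ (fun ij => `|x ij.1 ij.2|) (ord0, j)).
Qed.

(** The coordinate maps generate the sigma-algebra, so it is enough that a slab
a < x_i < b be a countable union of open boxes; the other sides are ]-k, k[. *)
Lemma measurable_rV_open_box n :
  @measurable _ 'rV[R]_n = <<s [set A | exists a b, A = @open_box n a b] >>.
Proof.
apply/seteqP; split; last first.
  apply: smallest_sub; first exact: sigma_algebra_measurable.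
  by move=> _ [a [b ->]]; exact: measurable_open_box.
set G := [set A | _].
pose SA := sigma_algebra_measurable (g_sigma_algebraType G).
apply: smallest_sub; first exact: smallest_sigma_algebra.
move=> B; rewrite -bigcup_seq => -[i _ [C mC <-]]; rewrite setTI.
have : @measurable _ R `<=` [set C | (<<s G>>) ((fun x : 'rV[R]_n => x ord0 i) @^-1` C)].
  rewrite [X in X `<=` _](RGenOpens.measurableE R).
  apply: smallest_sub.
    split => [|D GD|F GF] /=.
    - by rewrite preimage_set0; exact: (@measurable0 _ (g_sigma_algebraType G)).
    - by rewrite setTD preimage_setC; exact: (@measurableC _ (g_sigma_algebraType G)).
    - rewrite preimage_bigcup.
      by apply: (@bigcup_measurable _ (g_sigma_algebraType G)) => k _; exact: GF.
  move=> _ [a [b ->]] /=.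
  rewrite (_ : _ @^-1` _ = \bigcup_k (open_box
      (fun j => if j == i then a else - k%:R) (fun j => if j == i then b else k%:R))).
    apply: (@bigcup_measurable _ (g_sigma_algebraType G)) => k _.
    apply: sub_sigma_algebra.
    by exists (fun j => if j == i then a else - k%:R), (fun j => if j == i then b else k%:R).
  apply/seteqP; split => [x /= xab|x [k _ /= /(_ i)]]; last by rewrite eqxx.
  exists (Num.bound `|x|) => // j /=; case: ifPn => [/eqP ->//|_].
  by rewrite in_itv/= -ltr_norml coord_lt_bound.
by apply.
Qed.

(** Open boxes are stable under intersection and the cubes ]-k, k[^n exhaust R^n,
so the pi-lambda theorem applies. *)
Lemma rV_measure_unique n (m1 m2 : {measure set 'rV[R]_n -> \bar R}) :
  (forall a b, m1 (open_box a b) = m2 (open_box a b)) ->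
  (forall r : R, (m1 (open_box (fun=> - r)%R (fun=> r)) < +oo)%E) ->
  forall A, measurable A -> m1 A = m2 A.
Proof.
move=> m12 m1oo.
apply: (measure_unique [set A | exists a b, A = @open_box n a b]
  (fun k => open_box (fun=> - k%:R) (fun=> k%:R))).
- exact: measurable_rV_open_box.
- move=> _ _ [a [b ->]] [c [d ->]].
  exists (fun i => Order.max (a i) (c i)), (fun i => Order.min (b i) (d i)).
  apply/seteqP; split => [x [/= xab xcd] i|x /= xabcd].
    by have := xab i; have := xcd i; rewrite /= !in_itv/= gt_max lt_min => /andP[-> ->] /andP[-> ->].
  split => i; have := xabcd i; rewrite /= !in_itv/= gt_max lt_min.
    by move=> /andP[/andP[? ?] /andP[? ?]]; apply/andP.
  by move=> /andP[/andP[? ?] /andP[? ?]]; apply/andP.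
- by move=> k; exists (fun=> - k%:R), (fun=> k%:R).
- apply/seteqP; split => // x _; exists (Num.bound `|x|) => // j /=.
  by rewrite in_itv/= -ltr_norml coord_lt_bound.
- by move=> A [a [b ->]].
- by [].
Qed.

Lemma lebesgue_rV_open_box n (a b : 'I_n -> R) :
  lebesgue_rV (open_box a b) = (\prod_(i < n) (maxr 0 (b i - a i))%:E)%E.
Proof.
rewrite (lebesgue_rV_box (fun i => measurable_itv `]a i, b i[)).
apply: eq_bigr => i _; rewrite lebesgue_measure_itv/= lte_fin -EFinB.
case: ltP => ab; first by rewrite max_r// subr_ge0 ltW.
by rewrite max_l// subr_le0.
Qed.

Lemma lebesgue_rV_open_box_fin n (a b : 'I_n -> R) : (lebesgue_rV (open_box a b) < +oo)%E.
Proof. by rewrite lebesgue_rV_open_box prodEFin ltry. Qed.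

Lemma measurable_addrV n (v : 'rV[R]_n) : measurable_fun setT (fun x : 'rV[R]_n => x + v).
Proof.
apply: measurable_fun_rVP => i; under eq_fun do rewrite mxE.
by apply: measurable_funD => //; exact: measurable_coord_rV.
Qed.

Lemma measurable_scalerV n (r : R) : measurable_fun setT (fun x : 'rV[R]_n => r *: x).
Proof.
apply: measurable_fun_rVP => i; under eq_fun do rewrite mxE.
by apply: measurable_funM => //; exact: measurable_coord_rV.
Qed.

(** With m Lebesgue measure this gives its invariance under translations, with m a
multiple of it its behaviour under dilations. *)
Lemma rV_pushforward_unique n (m : {measure set 'rV[R]_n -> \bar R})
    (f : 'rV[R]_n -> 'rV[R]_n) : measurable_fun setT f ->
  (forall a b, m (open_box a b) = lebesgue_rV (f @^-1` open_box a b)) ->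
  (forall r : R, (m (open_box (fun=> - r)%R (fun=> r)) < +oo)%E) ->
  forall A, measurable A -> m A = lebesgue_rV (f @^-1` A).
Proof.
move=> mf mE moo A mA.
have [m' m'E] : exists m' : {measure set 'rV[R]_n -> \bar R},
    forall B, m' B = lebesgue_rV (f @^-1` B).
  by unshelve eexists (pushforward (@lebesgue_rV R n) f).
rewrite -m'E; apply: rV_measure_unique mA => // a b; rewrite m'E; exact: mE.
Qed.

Lemma lebesgue_rV_addr n (v : 'rV[R]_n) (A : set 'rV[R]_n) : measurable A ->
  lebesgue_rV ((fun x : 'rV[R]_n => x + v) @^-1` A) = lebesgue_rV A.
Proof.
move=> mA; apply/esym; apply: rV_pushforward_unique mA => //.
- exact: measurable_addrV.
- move=> a b; rewrite (_ : _ @^-1` _ =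
     open_box (fun i => a i - v ord0 i) (fun i => b i - v ord0 i)).
    rewrite [LHS]lebesgue_rV_open_box lebesgue_rV_open_box; apply: eq_bigr => i _; congr (maxr _ _)%:E; ring.
  by apply/seteqP; split => x /= xab i; have := xab i; rewrite /= !in_itv/= mxE ltrBlDr ltrBrDr.
- by move=> r; exact: lebesgue_rV_open_box_fin.
Qed.

Lemma lebesgue_rV_scale n (r : R) (A : set 'rV[R]_n) : 0 < r -> measurable A ->
  lebesgue_rV ((fun x : 'rV[R]_n => r^-1 *: x) @^-1` A) = ((r ^+ n)%:E * lebesgue_rV A)%E.
Proof.
move=> r0 mA; have rn0 : 0 <= r ^+ n by rewrite exprn_ge0// ltW.
apply/esym.
apply: (@rV_pushforward_unique n (mscale (NngNum rn0) (@lebesgue_rV R n))) mA.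
- exact: measurable_scalerV.
- move=> a b; rewrite /mscale /= (_ : _ @^-1` _ =
     open_box (fun i => r * a i) (fun i => r * b i)).
    transitivity ((r ^+ n)%:E * lebesgue_rV (open_box a b))%E => //.
    rewrite !lebesgue_rV_open_box !prodEFin -EFinM; congr EFin.
    under [RHS]eq_bigr => i _ do rewrite -mulrBr -[0](mulr0 r) -maxr_pMr ?ltW//.
    by rewrite big_split/= prodr_const card_ord.
  by apply/seteqP; split => x /= xab i; have := xab i; rewrite /= !in_itv/= mxE ltr_pdivrMl// ltr_pdivlMl.
- move=> t; have : ((r ^+ n)%:E * lebesgue_rV (@open_box n (fun=> - t)%R (fun=> t)) < +oo)%E by
    rewrite lebesgue_rV_open_box prodEFin -EFinM ltry.
  by [].
Qed.

Lemma ge0_integral_rV_addr n (v : 'rV[R]_n) (f : 'rV[R]_n -> \bar R) :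
  measurable_fun setT f -> (forall x, 0 <= f x)%E ->
  (\int[lebesgue_rV]_x f (x + v)%R = \int[lebesgue_rV]_x f x)%E.
Proof.
move=> mf f0.
have := @ge0_integral_pushforward _ _ _ _ R _ (measurable_addrV v) (@lebesgue_rV R n) setT f
  measurableT mf (fun _ _ => f0 _).
rewrite preimage_setT /= => <-.
apply: eq_measure_integral => [|mv A mA _]; first exact: measurable_addrV.
exact: (lebesgue_rV_addr v mA).
Qed.

Lemma eucl_norm_ge0 n (x : 'rV[R]_n) : 0 <= eucl_norm x.
Proof. exact: sqrtr_ge0. Qed.

Lemma sqr_eucl_norm n (x : 'rV[R]_n) : eucl_norm x ^+ 2 = \sum_i x ord0 i ^+ 2.
Proof. by rewrite sqr_sqrtr// sumr_ge0// => i _; exact: sqr_ge0. Qed.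

Lemma eucl_norm_eq0 n (x : 'rV[R]_n) : (eucl_norm x == 0) = (x == 0).
Proof.
apply/idP/idP => [/eqP x0|/eqP ->]; last first.
  by rewrite /eucl_norm big1 ?sqrtr0// => i _; rewrite mxE expr0n.
have := sqr_eucl_norm x; rewrite x0 expr0n/= => /esym/eqP.
rewrite psumr_eq0 => [/allP xi0|i _]; last exact: sqr_ge0.
apply/eqP/rowP => i; rewrite mxE; apply/eqP.
by have := xi0 i; rewrite mem_index_enum sqrf_eq0 => /(_ isT).
Qed.

Lemma eucl_normZ n (c : R) (x : 'rV[R]_n) : eucl_norm (c *: x) = `|c| * eucl_norm x.
Proof.
rewrite /eucl_norm -sqrtr_sqr -sqrtrM ?sqr_ge0// mulr_sumr; congr Num.sqrt.
by apply: eq_bigr => i _; rewrite mxE exprMn.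
Qed.

Lemma eucl_normN n (x : 'rV[R]_n) : eucl_norm (- x) = eucl_norm x.
Proof. by rewrite -scaleN1r eucl_normZ normrN1 mul1r. Qed.

Lemma eucl_norm_coord n (x : 'rV[R]_n) i : `|x ord0 i| <= eucl_norm x.
Proof.
rewrite -sqrtr_sqr /eucl_norm ler_sqrt; last by rewrite sumr_ge0// => j _; exact: sqr_ge0.
by rewrite (bigD1 i)//= lerDl sumr_ge0// => j _; exact: sqr_ge0.
Qed.

Lemma eucl_norm_le n (x : 'rV[R]_n) (r : R) : 0 <= r ->
  (eucl_norm x <= r) = (\sum_i x ord0 i ^+ 2 <= r ^+ 2).
Proof. by move=> r0; rewrite -sqr_eucl_norm ler_sqr// nnegrE eucl_norm_ge0. Qed.

Lemma eucl_normD n (x y : 'rV[R]_n) : eucl_norm (x + y) <= eucl_norm x + eucl_norm y.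
Proof.
rewrite eucl_norm_le ?addr_ge0 ?eucl_norm_ge0//.
rewrite sqrrD !sqr_eucl_norm.
set A := \sum_i x ord0 i ^+ 2; set B := \sum_i y ord0 i ^+ 2.
pose C := \sum_i x ord0 i * y ord0 i.
rewrite [leLHS](_ : _ = A + 2 * C + B); last first.
  rewrite /A /B /C mulr_sumr -!big_split/=; apply: eq_bigr => i _.
  by rewrite mxE; ring.
rewrite lerD2r lerD2l -[leRHS]mulr_natl ler_pM2l//.
(* Cauchy-Schwarz, from the sum of the (B x_i - C y_i)^2, which is B (A B - C^2). *)
have AB : C ^+ 2 <= A * B.
  have : 0 <= \sum_i (B * x ord0 i - C * y ord0 i) ^+ 2.
    by rewrite sumr_ge0// => i _; exact: sqr_ge0.
  rewrite (_ : \sum_i _ = B * (A * B - C ^+ 2)); last first.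
    transitivity (\sum_i (B ^+ 2 * x ord0 i ^+ 2 - 2 * B * C * (x ord0 i * y ord0 i)
       + C ^+ 2 * y ord0 i ^+ 2)); first by apply: eq_bigr => i _; ring.
    by rewrite !big_split/= sumrN -!mulr_sumr -/A -/B -/C; ring.
  have B0 : 0 <= B by rewrite sumr_ge0// => i _; exact: sqr_ge0.
  have [B00 _|Bn0] := eqVneq B 0; last first.
    by rewrite pmulr_rge0 ?subr_ge0// lt_def Bn0.
  rewrite B00 mulr0 (_ : C = 0) ?expr0n// /C big1// => i _.
  have := B00; rewrite /B => /eqP; rewrite psumr_eq0 => [/allP yi0|j _]; last exact: sqr_ge0.
  by have := yi0 i; rewrite mem_index_enum sqrf_eq0 => /(_ isT)/= /eqP ->; rewrite mulr0.
rewrite (le_trans (ler_norm _))// -sqrtr_sqr.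
rewrite /eucl_norm -/A -/B -sqrtrM; last by rewrite sumr_ge0// => i _; exact: sqr_ge0.
by rewrite ler_wsqrtr.
Qed.

Lemma measurable_eucl_norm n : measurable_fun setT (@eucl_norm R n).
Proof.
apply: measurableT_comp => //.
  by apply: continuous_measurable_fun; exact: sqrt_continuous.
apply: measurable_sum => i; apply: measurable_funX; exact: measurable_coord_rV.
Qed.

Definition eucl_ball n (c : 'rV[R]_n) (r : R) : set 'rV[R]_n :=
  [set x | eucl_norm (x - c) <= r].

Lemma measurable_eucl_ball n (c : 'rV[R]_n) r : measurable (eucl_ball c r).
Proof.
rewrite (_ : eucl_ball c r = (fun x => eucl_norm (x - c)) @^-1` `]-oo, r]); last first.
  by apply/seteqP; split => x /=; rewrite in_itv.
rewrite -[X in measurable X]setTI.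
apply: (measurableT_comp (@measurable_eucl_norm n) (measurable_addrV (- c))) => //.
Qed.

Lemma lebesgue_unit_ball_fin n :
  (lebesgue_rV (eucl_ball (0 : 'rV[R]_n) 1) < +oo)%E.
Proof.
apply: (@le_lt_trans _ _ (lebesgue_rV (@open_box n (fun=> - 2) (fun=> 2)))).
  apply: le_measure; rewrite ?inE.
  - exact: measurable_eucl_ball.
  - exact: measurable_open_box.
  - move=> x; rewrite /eucl_ball/= subr0 => x1 i /=.
    rewrite in_itv/= -ltr_norml (le_lt_trans (eucl_norm_coord _ _))//.
    by rewrite (le_lt_trans x1)// ltr1n.
exact: lebesgue_rV_open_box_fin.
Qed.

Lemma omegaE n : lebesgue_rV (eucl_ball (0 : 'rV[R]_n) 1) = (omega R n)%:E.
Proof.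
rewrite /omega (_ : [set x | _] = eucl_ball 0 1).
  by rewrite fineK// ge0_fin_numE// lebesgue_unit_ball_fin.
by apply/seteqP; split => x /=; rewrite /eucl_ball/= subr0.
Qed.

Lemma omega_gt0 n : 0 < omega R n.
Proof.
rewrite -lte_fin -omegaE.
(* The cube of half-side e lies in the unit ball, since n e^2 <= n e <= 1. *)
pose e : R := n.+1%:R^-1.
have e0 : 0 < e by rewrite invr_gt0.
apply: (@lt_le_trans _ _ (lebesgue_rV (@open_box n (fun=> - e) (fun=> e)))).
  rewrite lebesgue_rV_open_box prodEFin lte_fin prodr_gt0// => i _.
  by rewrite max_r; lra.
apply: le_measure; rewrite ?inE.
- exact: measurable_open_box.
- exact: measurable_eucl_ball.
- move=> x xe; rewrite /eucl_ball/= subr0 eucl_norm_le// expr1n.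
  apply: (@le_trans _ _ (\sum_(i < n) e)); last first.
    by rewrite sumr_const card_ord -mulr_natl ler_pdivrMr// mul1r ler_nat.
  apply: ler_sum => i _; have := xe i; rewrite /= in_itv/= -ltr_norml => xie.
  have e1 : e <= 1 by rewrite invf_le1// ler1n.
  rewrite -real_normK ?num_real// expr2 (le_trans (ler_pM _ _ (ltW xie) (ltW xie)))//.
  by rewrite ger_pMr.
Qed.

Lemma lebesgue_eucl_ball n (c : 'rV[R]_n) r : 0 < r ->
  lebesgue_rV (eucl_ball c r) = (r ^+ n * omega R n)%:E.
Proof.
move=> r0; have mb := measurable_eucl_ball.
rewrite EFinM -omegaE -lebesgue_rV_scale// -(lebesgue_rV_addr c)//.
congr (lebesgue_rV _); apply/seteqP; split => x /=.
  by rewrite /eucl_ball/= addrK subr0 eucl_normZ gtr0_norm ?invr_gt0// ler_pdivrMl// mulr1.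
by rewrite /eucl_ball/= addrK subr0 eucl_normZ gtr0_norm ?invr_gt0// ler_pdivrMl// mulr1.
Qed.

End boxes.

(** * Subadditivity of the L^p modulus *)

Section modulus.
Context {R : realType} {n : nat}.
Implicit Types (u f : 'rV[R]_n -> R) (h k x y : 'rV[R]_n) (p : \bar R).
Local Notation mu := (@lebesgue_rV R n).

Lemma measurable_shift d (U : measurableType d) (f : 'rV[R]_n -> U) h :
  measurable_fun setT f -> measurable_fun setT (fun x => f (x + h)).
Proof. by move=> mf; apply: measurableT_comp => //; exact: measurable_addrV. Qed.

Lemma ae_shift (P : 'rV[R]_n -> Prop) h :
  {ae mu, forall x, P x} -> {ae mu, forall x, P (x + h)}.
Proof.
move=> [N [mN N0 PN]]; exists ((fun x : 'rV[R]_n => x + h) @^-1` N); split.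
- rewrite -[X in measurable X]setTI; exact: measurable_addrV.
- by rewrite -N0; exact: lebesgue_rV_addr.
- by move=> x /= Px; exact: PN.
Qed.

Lemma lebesgue_rVT_gt0 : (0 < mu setT)%E.
Proof.
apply: (@lt_le_trans _ _ (mu (eucl_ball 0 1))).
  by rewrite omegaE lte_fin omega_gt0.
by apply: le_measure; rewrite ?inE//; exact: measurable_eucl_ball.
Qed.

Lemma Lnorm_shift f h p : (1 <= p)%E -> measurable_fun setT f ->
  ('N[mu]_p[(fun x => (f (x + h)%R)%:E)] = 'N[mu]_p[EFin \o f])%E.
Proof.
move=> p1 mf; rewrite unlock; case: p p1 => [p p1|_|//].
  congr (_ `^ _)%E.
  apply: (@ge0_integral_rV_addr R n h (fun x => (`| (f x)%:E | `^ p)%E)) => //.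
  - apply: (measurableT_comp (measurable_poweR p)).
    by apply: measurableT_comp => //; exact/measurable_EFinP.
  - by move=> x; exact: poweR_ge0.
rewrite lebesgue_rVT_gt0; apply/eqP; rewrite eq_le; apply/andP; split.
  apply/ess_supP; have := ess_sup_ge mu (abse \o (EFin \o f)).
  by move=> /(@ae_shift _ h).
apply/ess_supP; have := ess_sup_ge mu (abse \o (fun x => (f (x + h))%:E)).
by move=> /(@ae_shift _ (- h)); apply: filterS => x /=; rewrite subrK.
Qed.

Definition modulus p u h : \bar R := ('N[mu]_p[(fun x => (u (x + h)%R - u x)%:E)])%E.

Lemma modulus_ge0 p u h : (0 <= modulus p u h)%E.
Proof. exact: Lnorm_ge0. Qed.

Lemma modulus0 p u : (1 <= p)%E -> modulus p u 0 = 0%E.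
Proof.
move=> p1; rewrite /modulus (_ : (fun _ => _) = cst 0%E).
  by rewrite Lnorm0// gt_eqF// (lt_le_trans _ p1).
by apply/funext => x; rewrite addr0 subrr.
Qed.

Lemma measurable_diff u h : measurable_fun setT u ->
  measurable_fun setT (fun x => u (x + h) - u x).
Proof. by move=> mu_; apply: measurable_funB => //; exact: measurable_shift. Qed.

(** From x to x + h + k through x + h: the second increment is the increment by k,
translated by h, and the norm is translation invariant. *)
Lemma modulusD p u h k : (1 <= p)%E -> measurable_fun setT u ->
  (modulus p u (h + k) <= modulus p u h + modulus p u k)%E.
Proof.
move=> p1 mu_; rewrite /modulus.
rewrite -(@Lnorm_shift (fun x => u (x + k) - u x) h p p1 (measurable_diff _ mu_)).
have /= := @eminkowski _ _ R mu (fun x => u (x + h) - u x)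
  (fun x => u (x + h + k) - u (x + h)) p (measurable_diff _ mu_)
  (measurable_shift h (measurable_diff k mu_)) p1.
congr (_ <= _)%E; congr Lnorm; apply/funext => x /=; congr EFin.
by rewrite (addrA x h k); ring.
Qed.

Lemma modulus_muln p u h m : (1 <= p)%E -> measurable_fun setT u ->
  (modulus p u (h *+ m) <= m%:R%:E * modulus p u h)%E.
Proof.
move=> p1 mu_; elim: m => [|m IH]; first by rewrite mulr0n modulus0// mul0e.
rewrite mulrS (le_trans (modulusD _ _ p1 mu_))//.
rewrite -natr1 addrC EFinD ge0_muleDl// mul1e leeD//.
Qed.

Lemma modulus_le2 p u h : (1 <= p)%E -> measurable_fun setT u ->
  (modulus p u h <= 2%:E * 'N[mu]_p[EFin \o u])%E.
Proof.
move=> p1 mu_; rewrite (_ : 2%:E = (1 + 1)%:E)// EFinD ge0_muleDl// !mul1e.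
rewrite -{1}(Lnorm_shift h p1 mu_) -(oppe_Lnorm mu (EFin \o u)).
have := @eminkowski _ _ R mu (fun x => u (x + h)) (fun x => - u x) p.
by apply => //; [exact: measurable_shift|exact: measurableT_comp].
Qed.

(** The p-th power of the modulus, written as an integral so that averages over h and
Tonelli apply to it. *)
Definition modulus_pow (p : R) u h : \bar R :=
  (\int[mu]_x (`|u (x + h)%R - u x| `^ p)%:E)%E.

Lemma modulus_powE (p : R) u h : 1 <= p ->
  (modulus p%:E u h `^ p = modulus_pow p u h)%E.
Proof.
move=> p1; rewrite poweR_Lnorm//; last by rewrite gt_eqF// (lt_le_trans _ p1).
Qed.

Lemma modulus_pow_ge0 (p : R) u h : (0 <= modulus_pow p u h)%E.
Proof. by apply: integral_ge0 => x _; rewrite lee_fin powR_ge0. Qed.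

(** Convexity of t^p at the midpoint of |a| and |b|. *)
Lemma powR_normB_le (p a b : R) : 1 <= p ->
  `|a - b| `^ p <= 2 `^ (p - 1) * (`|a| `^ p + `|b| `^ p).
Proof.
move=> p1; have p0 : 0 <= p by lra.
have h : ((`|a| + `|b|) / 2) `^ p <= (`|a| `^ p + `|b| `^ p) / 2.
  rewrite !(mulrC _ 2^-1) !mulrDr {2 4}(_ : 2^-1 = 1 - 2^-1); last by field.
  by apply: (convex_powR p1 (Itv01 _ _)) => //=;
    rewrite ?inE/= ?in_itv/= ?normr_ge0// ?invr_ge0// invf_le1 ?ler1n.
apply: (@le_trans _ _ ((`|a| + `|b|) `^ p)).
  by apply: ge0_ler_powR => //; rewrite ?nnegrE ?addr_ge0// ler_normB.
rewrite (_ : `|a| + `|b| = 2 * ((`|a| + `|b|) / 2)); last by field.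
rewrite powRM ?divr_ge0 ?addr_ge0//.
have -> : (2 : R) `^ p = 2 `^ (p - 1) * 2.
  rewrite -{1}(subrK 1 p) (@powRD _ _ (p - 1)) ?powRr1//.
  by apply/implyP => _; rewrite pnatr_eq0.
rewrite -mulrA ler_pM2l ?powR_gt0// mulrC.
by move: h; rewrite ler_pdivlMr.
Qed.

Lemma measurable_powR_diff (p : R) u h : measurable_fun setT u ->
  measurable_fun setT (fun x => (`|u (x + h)%R - u x| `^ p)%:E).
Proof.
move=> mu_; apply/measurable_EFinP.
apply: (@measurableT_comp _ _ _ _ _ _ (@powR R ^~ p)) => //.
by apply: measurableT_comp => //; exact: measurable_diff.
Qed.

(** From x to x + y through x + h; the second increment is the increment by h - y,
translated by y. The free h is what will be averaged over. *)
Lemma modulus_pow_split (p : R) u y h : 1 <= p -> measurable_fun setT u ->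
  (modulus_pow p u y <=
   (2 `^ (p - 1))%:E * (modulus_pow p u h + modulus_pow p u (h - y)%R))%E.
Proof.
move=> p1 mu_.
have -> : modulus_pow p u (h - y) = (\int[mu]_x (`|u (x + h)%R - u (x + y)%R| `^ p)%:E)%E.
  rewrite /modulus_pow -(ge0_integral_rV_addr y); last 2 first.
  - exact: measurable_powR_diff.
  - by move=> x; rewrite lee_fin powR_ge0.
  by apply: eq_integral => x _; rewrite -addrA (addrCA y) subrr addr0.
have m2 : measurable_fun setT (fun x => (`|u (x + h)%R - u (x + y)%R| `^ p)%:E).
  apply/measurable_EFinP.
  apply: (@measurableT_comp _ _ _ _ _ _ (@powR R ^~ p)) => //.
  by apply: measurableT_comp => //; apply: measurable_funB; exact: measurable_shift.
have m1 := measurable_powR_diff p h mu_.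
rewrite /modulus_pow -ge0_integralD//.
rewrite -ge0_integralZl//; last 2 first.
- exact: emeasurable_funD.
- by move=> x _; rewrite adde_ge0.
apply: ge0_le_integral => //.
- exact: measurable_powR_diff.
- by apply: emeasurable_funM => //; exact: emeasurable_funD.
- move=> x _; rewrite -EFinD -EFinM lee_fin.
  apply: le_trans (powR_normB_le _ _ p1).
  rewrite (_ : u (x + h) - u x - (u (x + h) - u (x + y)) = u (x + y) - u x)//.
  by ring.
Qed.

End modulus.

(** * Averages of the modulus over balls *)

Section average.
Context {R : realType} {n : nat}.
Implicit Types (u f : 'rV[R]_n -> R) (h k x y : 'rV[R]_n) (p : R).
Local Notation mu := (@lebesgue_rV R n).

Lemma measurable_shift2 u : measurable_fun setT u ->
  measurable_fun setT (fun z : 'rV[R]_n * 'rV[R]_n => u (z.2 + z.1)).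
Proof.
move=> mu_; apply: (measurableT_comp mu_).
apply: measurable_fun_rVP => i; under eq_fun do rewrite mxE.
by apply: measurable_funD; apply: (measurableT_comp (measurable_coord_rV i)).
Qed.

Lemma measurable_powR_diff2 p u : measurable_fun setT u ->
  measurable_fun setT (fun z : 'rV[R]_n * 'rV[R]_n =>
    (`|u (z.2 + z.1)%R - u z.2| `^ p)%:E).
Proof.
move=> mu_; apply/measurable_EFinP.
apply: (@measurableT_comp _ _ _ _ _ _ (@powR R ^~ p)) => //.
apply: measurableT_comp => //; apply: measurable_funB.
  exact: measurable_shift2.
exact: (measurableT_comp mu_).
Qed.

Lemma measurable_modulus_pow p u : measurable_fun setT u ->
  measurable_fun setT (modulus_pow p u).
Proof.
move=> mu_; apply: (measurable_fun_fubini_tonelli_F _ (measurable_powR_diff2 p mu_)).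
by move=> z; rewrite lee_fin powR_ge0.
Qed.

Lemma le_poweR (r : R) (a b : \bar R) : 0 <= r -> (0 <= a)%E -> (a <= b)%E ->
  (a `^ r <= b `^ r)%E.
Proof.
move=> r0 a0 ab; have b0 := le_trans a0 ab.
by apply: gt0_ler_poweR => //; rewrite in_itv/= leey ?a0 ?b0.
Qed.

(** The ratio of the volumes of the balls of radii (1 - 1/(2m)) t and t in dimension m
is at least 1/2, by Bernoulli's inequality. *)
Lemma bernoulli_half (m : nat) : (0 < m)%N ->
  2^-1 <= (1 - (2 * m%:R)^-1 : R) ^+ m.
Proof.
move=> m0; have m0' : (0 : R) < m%:R by rewrite ltr0n.
set a : R := (2 * m%:R)^-1.
have a0 : 0 <= a by rewrite invr_ge0 mulr_ge0.
have a1 : a <= 1.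
  rewrite invf_le1 ?mulr_gt0//.
  have : (1 : R) <= m%:R by rewrite ler1n.
  lra.
have H (k : nat) : 1 - k%:R * a <= (1 - a) ^+ k.
  elim: k => [|j IH]; first by rewrite mul0r subr0 expr0.
  rewrite exprS; apply: le_trans (ler_wpM2l _ IH); last by rewrite subr_ge0.
  rewrite -natr1; have : 0 <= (j%:R : R) by rewrite ler0n.
  by nra.
apply: le_trans (H m); rewrite /a.
by rewrite invfM mulrCA divff ?gt_eqF// mulr1; lra.
Qed.

(** Let A be the ball of centre y/2 and radius (1 - 1/(2n)) t. As |y|/2 <= t/(2n), both
A and A - y lie in the ball B of centre 0 and radius t. Averaging the inequality
O y <= C (O h + O (h - y)) over h in A bounds mu(A) O(y) by 2 C times the integral of O
over B, and A has at least half the volume of B. Shrinking the radius by the factor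
1 - 1/(2n) only is what keeps this proportion independent of the dimension. *)
Lemma ball_average_small (O : 'rV[R]_n -> \bar R) (C : R) y t :
  measurable_fun setT O -> (forall h, 0 <= O h)%E -> 0 <= C ->
  (forall h, O y <= C%:E * (O h + O (h - y)%R))%E ->
  (0 < n)%N -> 0 < t -> n%:R * eucl_norm y <= t ->
  ((t ^+ n * omega R n)%:E * O y <=
   (4 * C)%:E * \int[mu]_(h in eucl_ball 0 t) O h)%E.
Proof.
move=> mO O0 C0 Osplit n0 t0 yt.
have n1 : (1 : R) <= n%:R by rewrite ler1n.
pose r := (1 - (2 * n%:R)^-1) * t.
have nV : 0 < (2 * n%:R)^-1 :> R by rewrite invr_gt0; lra.
have nV1 : (2 * n%:R)^-1 < 1 :> R by rewrite invf_lt1; lra.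
have r0 : 0 < r by rewrite mulr_gt0//; lra.
have rt : r + eucl_norm y / 2 <= t.
  have : eucl_norm y / 2 <= (2 * n%:R)^-1 * t.
    rewrite invfM mulrC -mulrA ler_pM2l// ler_pdivlMl//; lra.
  by rewrite /r mulrBl mul1r; lra.
pose A := eucl_ball (2^-1 *: y) r.
pose I := (\int[mu]_(h in eucl_ball 0 t) O h)%E.
have mB := @measurable_eucl_ball R n.
have mA : measurable A by exact: mB.
have mOy : measurable_fun setT (fun h => O (h - y)) := measurable_shift (- y) mO.
have A1 : (\int[mu]_(h in A) O h <= I)%E.
  apply: ge0_subset_integral; [exact: mB|exact: mB|..].
  - exact: measurable_funTS.
  - by [].
  - move=> h; rewrite /A /eucl_ball/= subr0 => hr; apply: le_trans rt.
    rewrite -[h in leLHS](subrK (2^-1 *: y)) (le_trans (eucl_normD _ _))// lerD//.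
    by rewrite eucl_normZ ger0_norm// mulrC.
have A2 : (\int[mu]_(h in A) O (h - y)%R <= I)%E.
  pose A' := eucl_ball (- (2^-1 *: y)) r.
  rewrite (_ : (\int[mu]_(h in A) _ = \int[mu]_(h in A') O h)%E).
    apply: ge0_subset_integral; [exact: mB|exact: mB|..].
    - exact: measurable_funTS.
    - by [].
    - move=> h; rewrite /A' /eucl_ball/= subr0 opprK => hr; apply: le_trans rt.
      rewrite -[h in leLHS](addrK (2^-1 *: y)) (le_trans (eucl_normD _ _))// lerD//.
      by rewrite eucl_normN eucl_normZ ger0_norm// mulrC.
  rewrite integral_mkcond [RHS]integral_mkcond.
  rewrite -[RHS](ge0_integral_rV_addr (- y)).
  - apply: eq_integral => h _; rewrite !patchE.
    rewrite (_ : (h \in A) = (h - y \in A'))//.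
    have E : h - 2^-1 *: y = h - y - - (2^-1 *: y).
      by apply/rowP => j; rewrite !mxE; field.
    by apply/idP/idP; rewrite !inE /A /A' /eucl_ball/= E.
  - by apply/(measurable_restrictT _ _).1; [exact: mB|exact: measurable_funTS].
  - by move=> h; rewrite patchE; case: ifP.
have muA : mu A = (r ^+ n * omega R n)%:E by rewrite lebesgue_eucl_ball.
have key : (mu A * O y <= C%:E * (I + I))%E.
  rewrite muleC -integral_cst//.
  apply: (@le_trans _ _ (\int[mu]_(h in A) (C%:E * (O h + O (h - y)%R)))%E).
    apply: ge0_le_integral => //.
      by move=> ? _; exact: O0.
    apply: emeasurable_funM => //; apply: emeasurable_funD.
      exact: measurable_funTS.
    exact: (measurable_funTS mOy).
  rewrite ge0_integralZl//; first last.
  - by move=> ? _; rewrite adde_ge0.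
  - apply: emeasurable_funD; first exact: measurable_funTS.
    exact: (measurable_funTS mOy).
  rewrite lee_wpmul2l// ge0_integralD//; first exact: leeD.
  - exact: measurable_funTS.
  - exact: (measurable_funTS mOy).
have I0 : (0 <= I)%E by apply: integral_ge0.
have mul2 (z : \bar R) : (0 <= z)%E -> (z + z = 2%:E * z)%E.
  by move=> z0; rewrite (_ : 2%:E = (1 + 1)%:E)// EFinD ge0_muleDl// mul1e.
apply: (@le_trans _ _ (2%:E * (mu A * O y))%E).
  rewrite muleA muA -EFinM lee_wpmul2r// lee_fin.
  rewrite mulrA ler_pM2r ?omega_gt0// /r exprMn mulrA -[leLHS]mul1r ler_pM2r ?exprn_gt0//.
  by have := bernoulli_half n0; lra.
apply: (@le_trans _ _ (2%:E * (C%:E * (I + I)))%E).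
  by rewrite lee_wpmul2l.
rewrite mul2// !muleA -!EFinM lee_wpmul2r// lee_fin.
by rewrite [leLHS](_ : _ = 4 * C)//; ring.
Qed.

(** [ball_average_small] with C = 2^(p-1): the constant 4 C is at most 4^p. *)
Lemma modulus_pow_small p u y t : 1 <= p -> measurable_fun setT u ->
  (0 < n)%N -> 0 < t -> n%:R * eucl_norm y <= t ->
  ((t ^+ n * omega R n)%:E * modulus_pow p u y <=
   (4 `^ p)%:E * \int[mu]_(h in eucl_ball 0 t) modulus_pow p u h)%E.
Proof.
move=> p1 mu_ n0 t0 yt.
have H := @ball_average_small (modulus_pow p u) (2 `^ (p - 1)) y t
  (measurable_modulus_pow p mu_) (modulus_pow_ge0 p u) (powR_ge0 _ _)
  (fun h => modulus_pow_split y h p1 mu_) n0 t0 yt.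
apply: (le_trans H); apply: lee_wpmul2r.
  by apply: integral_ge0 => h _; exact: modulus_pow_ge0.
have p21 : (2 : R) `^ (p - 1) * 2 = 2 `^ p.
  rewrite -{2}(subrK 1 p) (@powRD _ _ (p - 1)) ?powRr1//.
  by apply/implyP => _; rewrite pnatr_eq0.
rewrite lee_fin (_ : 4 = 2 * 2 :> R); last by ring.
rewrite powRM// -mulrA (mulrC 2 (2 `^ _)) p21 ler_pM2r ?powR_gt0//.
by rewrite -{1}[2](@powRr1 _ 2)// ler_powR// ler1n.
Qed.

(** With m the integer part of n|y|/t plus one, [modulus_pow_small] applies to y/m, and
going back to y costs m^p. Since m min(t/|y|, 1) <= n + 1, the factor
min(t/|y|, 1)^p compensates this cost. *)
Lemma modulus_pow_ball p u y t : 1 <= p -> measurable_fun setT u ->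
  (0 < n)%N -> 0 < t -> 0 < eucl_norm y ->
  ((t ^+ n * omega R n * minr (t / eucl_norm y) 1 `^ p)%:E * modulus_pow p u y <=
   ((4 * (n%:R + 1)) `^ p)%:E * \int[mu]_(h in eucl_ball 0 t) modulus_pow p u h)%E.
Proof.
move=> p1 mu_ n0 t0 y0; set rho := eucl_norm y.
have p0 : 0 < p by lra.
have nrt : 0 <= n%:R * rho / t by rewrite divr_ge0 ?mulr_ge0// ltW.
pose m := (Num.truncn (n%:R * rho / t)).+1.
have m0 : (0 : R) < m%:R by rewrite ltr0n.
have m1 : n%:R * rho / t < m%:R by exact: truncnS_gt.
have m2 : m%:R <= n%:R * rho / t + 1 :> R.
  by rewrite /m -natr1 lerD2r truncn_le.
pose y' := m%:R^-1 *: y.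
have yE : y = y' *+ m by rewrite /y' -scaler_nat scalerA divff ?gt_eqF// scale1r.
have y't : n%:R * eucl_norm y' <= t.
  rewrite eucl_normZ gtr0_norm ?invr_gt0// mulrCA ler_pdivrMl//.
  by rewrite -ler_pdivrMr// ltW.
have H1 : (modulus_pow p u y <= (m%:R `^ p)%:E * modulus_pow p u y')%E.
  rewrite -!modulus_powE// -poweR_EFin -poweRM ?modulus_ge0 ?lee_fin ?(ltW m0)//.
  apply: le_poweR; [exact: ltW|exact: modulus_ge0|].
  by rewrite {1}yE; exact: modulus_muln.
have H2 := modulus_pow_small p1 mu_ n0 t0 y't.
set mn := minr _ _; have mn0 : 0 < mn by rewrite lt_min ltr01 divr_gt0.
have mmn : m%:R * mn <= n%:R + 1.
  rewrite /mn; case: (leP (t / rho) 1) => [trho|trho].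
    apply: (@le_trans _ _ ((n%:R * rho / t + 1) * (t / rho))).
      by rewrite ler_pM2r// divr_gt0.
    rewrite mulrDl mul1r lerD//.
    rewrite (_ : n%:R * rho / t * (t / rho) = n%:R)//.
    by field; rewrite !gt_eqF.
  rewrite mulr1 (le_trans m2)// lerD2r -mulrA ger_pMr ?ltr0n//.
  by rewrite ler_pdivrMr// mul1r ltW//; move: trho; rewrite ltr_pdivlMr// mul1r.
apply: (@le_trans _ _ (((n%:R + 1) `^ p)%:E * ((t ^+ n * omega R n)%:E * modulus_pow p u y'))%E).
  apply: (@le_trans _ _ ((t ^+ n * omega R n * mn `^ p)%:E * ((m%:R `^ p)%:E * modulus_pow p u y'))%E).
    by rewrite lee_wpmul2l// lee_fin !mulr_ge0 ?exprn_ge0 ?powR_ge0 ?ltW ?omega_gt0.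
  rewrite !muleA -!EFinM lee_wpmul2r ?modulus_pow_ge0// lee_fin.
  rewrite [leRHS]mulrC -[leLHS]mulrA ler_pM2l ?mulr_gt0 ?exprn_gt0 ?omega_gt0//.
  rewrite -powRM ?(ltW mn0) ?(ltW m0)// (mulrC mn).
  by rewrite ge0_ler_powR ?nnegrE ?mulr_ge0 ?(ltW p0) ?(ltW mn0) ?(ltW m0) ?addr_ge0.
rewrite (@powRM _ 4) ?addr_ge0// (mulrC (4 `^ p)) (EFinM (_ `^ _)) -[leRHS]muleA.
by apply: lee_wpmul2l; [rewrite lee_fin powR_ge0|exact: H2].
Qed.

End average.

(** * One-dimensional power integrals *)

Section powers.
Context {R : realType}.
Implicit Types (a b c d s p rho t : R).
Local Notation leb := (@lebesgue_measure R).

Lemma continuous_powR_gt0 a t : 0 < t -> {for t, continuous (fun x : R => x `^ a)}.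
Proof.
move=> t0; apply: differentiable_continuous; apply/derivable1_diffP.
exact: (@ex_derive _ _ _ _ _ _ _ (is_derive1_powR a t0)).
Qed.

Lemma integral_powR a c d : 0 < c -> c < d -> a != 0 ->
  (\int[leb]_(t in `[c, d]) (t `^ (a - 1))%:E = ((d `^ a - c `^ a) / a)%:E)%E.
Proof.
move=> c0 cd a0.
rewrite (@continuous_FTC2 _ _ (fun t => a^-1 * t `^ a) _ _ cd).
- by rewrite -EFinB -mulrBr mulrC.
- apply: continuous_in_subspaceT => x; rewrite inE/= in_itv/= => /andP[cx _].
  by apply: continuous_powR_gt0; exact: lt_le_trans cx.
- have F x : c <= x -> {for x, continuous (fun t : R => a^-1 * t `^ a)}.
    move=> cx; apply: continuousM; first exact: cst_continuous.
    by apply: continuous_powR_gt0; exact: lt_le_trans cx.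
  split.
  + move=> x; rewrite in_itv/= => /andP[cx _].
    have x0 : 0 < x by exact: lt_trans cx.
    apply: derivableM => //.
    exact: (@ex_derive _ _ _ _ _ _ _ (is_derive1_powR a x0)).
  + by apply: cvg_at_right_filter; exact: F.
  + by apply: cvg_at_left_filter; apply: F; exact: ltW.
- move=> x; rewrite in_itv/= => /andP[cx _].
  have x0 : 0 < x by exact: lt_trans cx.
  have D := is_derive1_powR a x0.
  rewrite derive1E deriveZ/=; last exact: ex_derive.
  by rewrite derive_val scalerA mulVf// scale1r.
Qed.

Lemma measurable_powR_tail b rho : measurable_fun setT
  (fun t : R => if rho <= t then t `^ (- b - 1) else 0).
Proof.
apply: measurable_fun_ifT => //.
  by apply: measurable_fun_ler.
Qed.

(** The bound is uniform in c and d, so that integrals over compact intervals suffice in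
the layer cake formula. *)
Lemma integral_powR_tail b rho c d : 0 < b -> 0 < rho ->
  (\int[leb]_(t in `[c, d]) (if rho <= t then t `^ (- b - 1) else 0)%:E
   <= (rho `^ (- b) / b)%:E)%E.
Proof.
move=> b0 rho0.
pose M := maxr rho d + 1.
have rM : rho < M by rewrite (@le_lt_trans _ _ (maxr rho d)) ?ltrDl// le_max lexx.
apply: (@le_trans _ _ (\int[leb]_(t in `[rho, M]) (t `^ (- b - 1))%:E)%E).
  rewrite integral_mkcond [leRHS]integral_mkcond.
  apply: ge0_le_integral => //.
  - by move=> x _; rewrite patchE; case: ifP => // _; rewrite lee_fin; case: ifP => // _; exact: powR_ge0.
  - apply/(measurable_restrictT _ _).1 => //; apply: measurable_funTS.
    by apply/measurable_EFinP; exact: measurable_powR_tail.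
  - apply/(measurable_restrictT _ _).1 => //; apply: measurable_funTS.
    by apply/measurable_EFinP; exact: measurable_powR.
  - move=> x _; rewrite !patchE; case: ifP => [|_]; last first.
      by case: ifP => // _; rewrite lee_fin powR_ge0.
    rewrite inE/= in_itv/= => /andP[_ xd].
    case: ifPn => rx; last by case: ifP => // _; rewrite lee_fin powR_ge0.
    rewrite ifT// inE/= in_itv/= rx/= (@le_trans _ _ (maxr rho d)) ?lerDl//.
    by rewrite le_max xd orbT.
rewrite integral_powR// ?oppr_eq0 ?gt_eqF// lee_fin invrN mulrN -mulNr opprB.
by rewrite ler_pM2r ?invr_gt0// gerBl powR_ge0.
Qed.

(** The integral over all t > 0 is rho^(-sp) / (p s (1 - s)): the part t <= rho
contributes rho^(-sp) / (p (1 - s)), the part t >= rho contributes rho^(-sp) / (s p).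
The interval from rho lam to rho / lam loses the proportions lam^(p(1-s)) and lam^(sp)
of these two parts, hence reaches any proportion th < 1 of the total. *)
Lemma integral_min_powR s p rho th : 0 < s < 1 -> 1 <= p -> 0 < rho -> 0 < th < 1 ->
  exists c d, [/\ 0 < c, c < d &
   ((th * (rho `^ (- (s * p)) / (p * s * (1 - s))))%:E <=
   \int[leb]_(t in `[c, d]) (t `^ (- (s * p) - 1) * minr (t / rho) 1 `^ p)%:E)%E].
Proof.
move=> /andP[s0 s1] p1 rho0 /andP[th0 th1]; have p0 : 0 < p by lra.
pose a1 := p * (1 - s); pose a2 := s * p.
have a10 : 0 < a1 by rewrite mulr_gt0// subr_gt0.
have a20 : 0 < a2 by rewrite mulr_gt0.
have th'0 : 0 < 1 - th by lra.
(* One lam serves both exponents: a1^-1 + a2^-1 times a1 or a2 is at least 1. *)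
have [lam [lam0 l1 l2]] : exists lam,
    [/\ 0 < lam, lam `^ a1 <= 1 - th & lam `^ a2 <= 1 - th].
  have H a : 0 < a -> a^-1 <= a1^-1 + a2^-1 ->
      ((1 - th) `^ (a1^-1 + a2^-1)) `^ a <= 1 - th.
    move=> a0 aa; rewrite -powRrM -[leRHS](@powRr1 _ (1 - th)) ?(ltW th'0)//.
    rewrite ger_powR//; first by apply/andP; split; lra.
    by rewrite -ler_pdivrMr// div1r.
  exists ((1 - th) `^ (a1^-1 + a2^-1)); split; first exact: powR_gt0.
    by apply: H => //; rewrite lerDl invr_ge0 ltW.
  by apply: H => //; rewrite lerDr invr_ge0 ltW.
have lam1 : lam < 1.
  rewrite ltNge; apply/negP => lam1.
  have : 1 `^ a1 <= lam `^ a1 by rewrite ge0_ler_powR ?nnegrE ?(ltW a10) ?(ltW lam0).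
  rewrite powR1.
  by lra.
pose c := rho * lam; pose d := rho / lam.
have c0 : 0 < c by rewrite mulr_gt0.
have crho : c < rho by rewrite gtr_pMr.
have rhod : rho < d by rewrite ltr_pdivlMr// gtr_pMr.
exists c, d; split => //; first exact: lt_trans rhod.
have [f fE] : exists f : R -> \bar R,
    f = fun t => (t `^ (- (s * p) - 1) * minr (t / rho) 1 `^ p)%:E by eexists.
rewrite -fE.
have mf : measurable_fun setT f.
  rewrite fE; apply/measurable_EFinP; apply: measurable_funM.
    exact: measurable_powR.
  apply: (@measurableT_comp _ _ _ _ _ _ (@powR R ^~ p)) => //.
  by apply: measurable_minr => //; exact: measurable_funM.
have f0 t : (0 <= f t)%E by rewrite fE lee_fin mulr_ge0// powR_ge0.
have -> : `[c, d]%classic = `[c, rho[%classic `|` `[rho, d]%classic.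
  apply/seteqP; split => [t /=|t [] /=]; rewrite !in_itv/= => /andP[ct td].
  - by case: (ltP t rho) => tr; [left|right]; apply/andP.
  - by rewrite ct (le_trans (ltW td))// ltW.
  - by rewrite td (le_trans _ ct)// ltW.
rewrite ge0_integral_setU//; last 2 first.
- exact: measurable_funTS.
- apply/disj_setPS => t [] /=; rewrite !in_itv/= => /andP[_ tr] /andP[rt _].
  by move: tr; rewrite ltNge rt.
rewrite integral_itv_bndo_bndc; last exact: measurable_funTS.
have -> : (\int[leb]_(t in `[c, rho]) f t =
    \int[leb]_(t in `[c, rho]) ((rho `^ (- p))%:E * (t `^ (a1 - 1))%:E))%E.
  apply: eq_integral => t; rewrite inE/= in_itv/= => /andP[ct tr].
  have t0 : 0 < t by exact: lt_le_trans ct.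
  rewrite fE min_l ?ler_pdivrMr ?mul1r// -EFinM; congr EFin.
  rewrite powRM ?invr_ge0 ?(ltW t0) ?(ltW rho0)// -powR_inv1 ?(ltW rho0)//.
  rewrite -powRrM mulN1r mulrA -powRD; last by rewrite (gt_eqF t0) implybT.
  by rewrite mulrC; congr (_ * _ `^ _); rewrite /a1; ring.
have -> : (\int[leb]_(t in `[rho, d]) f t =
    \int[leb]_(t in `[rho, d]) (t `^ (- a2 - 1))%:E)%E.
  apply: eq_integral => t; rewrite inE/= in_itv/= => /andP[rt td].
  by rewrite fE min_r ?ler_pdivlMr ?mul1r// powR1 mulr1.
rewrite ge0_integralZl//; last first.
- by rewrite lee_fin powR_ge0.
- by move=> t _; rewrite lee_fin powR_ge0.
- by apply/measurable_EFinP; apply: measurable_funTS; exact: measurable_powR.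
rewrite !integral_powR ?oppr_eq0 ?gt_eqF// -EFinM -EFinD lee_fin.
have rn0 := gt_eqF rho0.
have X0 : 0 < rho `^ (- a2) by exact: powR_gt0.
have -> : c `^ a1 = rho `^ a1 * lam `^ a1.
  by rewrite powRM ?(ltW rho0) ?(ltW lam0).
have -> : d `^ (- a2) = rho `^ (- a2) * lam `^ a2.
  have lamV0 : 0 <= lam^-1 by rewrite invr_ge0 ltW.
  rewrite /d (powRM _ (ltW rho0) lamV0); congr (_ * _).
  by rewrite -(powR_inv1 (ltW lam0)) -powRrM mulN1r opprK.
have -> : rho `^ (- p) * ((rho `^ a1 - rho `^ a1 * lam `^ a1) / a1) =
    rho `^ (- a2) * ((1 - lam `^ a1) / a1).
  have <- : rho `^ (- p) * rho `^ a1 = rho `^ (- a2).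
    rewrite -powRD ?rn0 ?implybT//; congr (_ `^ _).
    by rewrite /a1 /a2; ring.
  by ring.
rewrite -/a2 (_ : (rho `^ (- a2) * lam `^ a2 - rho `^ (- a2)) / - a2 =
    rho `^ (- a2) * ((1 - lam `^ a2) / a2)); last first.
  by field; rewrite gt_eqF.
rewrite -mulrDr mulrCA ler_pM2l//.
have -> : th / (p * s * (1 - s)) = th / a1 + th / a2.
  by rewrite /a1 /a2; field; rewrite !gt_eqF// subr_gt0.
by apply: lerD; rewrite ler_pM2r ?invr_gt0//; lra.
Qed.

End powers.

(** * Layer cake for the Gagliardo integral *)

Section layer_cake.
Context {R : realType} {n : nat}.
Local Notation mu := (@lebesgue_rV R n).
Local Notation leb := (@lebesgue_measure R).

Lemma measurable_ball_integral (O : 'rV[R]_n -> \bar R) :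
  measurable_fun setT O -> (forall h, 0 <= O h)%E ->
  measurable_fun setT (fun t : R => \int[mu]_(h in eucl_ball 0%R t) O h)%E.
Proof.
move=> mO O0.
pose G (z : 'rV[R]_n * measurableTypeR R) :=
  (O z.1 * (if eucl_norm z.1 <= z.2 then 1 else 0)%:E)%E.
have G0 z : (0 <= G z)%E by rewrite mule_ge0// lee_fin; case: ifP.
have mG : measurable_fun setT G.
  apply: emeasurable_funM; first exact: (measurableT_comp mO).
  apply/measurable_EFinP; apply: measurable_fun_ifT => //.
  by apply: measurable_fun_ler => //; exact: (measurableT_comp (@measurable_eucl_norm R n)).
rewrite (_ : (fun t => _) = fun t => \int[mu]_h G (h, t))%E.
  exact: measurable_fun_fubini_tonelli_G.
apply/funext => t; rewrite integral_mkcond; apply: eq_integral => h _.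
rewrite patchE /G/=.
have -> : (h \in eucl_ball 0 t) = (eucl_norm h <= t).
  by rewrite /eucl_ball; apply/idP/idP; rewrite inE/= subr0.
by case: ifP => _; rewrite ?mule1 ?mule0.
Qed.

(** For h <> 0, |h|^(-b) / b is the integral of t^(-b-1) over t >= |h|; exchange the
integrals in t and h. At h = 0 the weight in the right-hand side is the default value
of the power, and the condition on O 0 makes it harmless. *)
Lemma layer_cake_le (O : 'rV[R]_n -> \bar R) (b c d : R) :
  measurable_fun setT O -> (forall h, 0 <= O h)%E -> O 0 = 0%E -> 0 < b ->
  (\int[leb]_(t in `[c, d])
     ((t `^ (- b - 1))%:E * \int[mu]_(h in eucl_ball 0 t) O h) <=
   (b^-1)%:E * \int[mu]_h (O h * (eucl_norm h `^ (- b))%:E))%E.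
Proof.
move=> mO O0 O00 b0.
pose w (h : 'rV[R]_n) (t : R) := if eucl_norm h <= t then t `^ (- b - 1) else 0.
have w0 h t : 0 <= w h t by rewrite /w; case: ifP => // _; exact: powR_ge0.
pose G (z : 'rV[R]_n * measurableTypeR R) :=
  (O z.1 * (w z.1 z.2 * \1_(`[c, d]%classic : set R) z.2)%:E)%E.
have G0 z : (0 <= G z)%E by rewrite mule_ge0// lee_fin mulr_ge0.
have mG : measurable_fun setT G.
  apply: emeasurable_funM; first exact: (measurableT_comp mO).
  apply/measurable_EFinP; apply: measurable_funM.
    apply: measurable_fun_ifT => //.
      by apply: measurable_fun_ler => //; exact: (measurableT_comp (@measurable_eucl_norm R n)).
    exact: (measurableT_comp (measurable_powR _)).
  exact: (measurableT_comp (measurable_indic _)).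
have mw h : measurable_fun setT (fun t : measurableTypeR R => (w h t)%:E).
  by apply/measurable_EFinP; exact: measurable_powR_tail.
have L : (\int[leb]_(t in `[c, d])
     ((t `^ (- b - 1))%:E * \int[mu]_(h in eucl_ball 0%R t) O h) =
    \int[leb]_t \int[mu]_h G (h, t))%E.
  rewrite integral_mkcond; apply: eq_integral => t _; rewrite patchE.
  have IE : \1_(`[c, d]%classic : set R) t = (t \in `[c, d]%classic)%:R :> R by rewrite indicE.
  rewrite /G/= IE.
  case: ifPn => [tcd|tcd]; last first.
    by rewrite [RHS]integral0_eq// => h _; rewrite mulr0 mule0.
  rewrite integral_mkcond -ge0_integralZl//.
  - apply: eq_integral => h _; rewrite patchE mulr1 /w.
    have -> : (h \in eucl_ball 0 t) = (eucl_norm h <= t).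
      by rewrite /eucl_ball; apply/idP/idP; rewrite inE/= subr0.
    by case: ifP => _; rewrite ?mule0 ?mulr0 ?mule0// muleC.
  - apply/(measurable_restrictT _ _).1; first exact: measurable_eucl_ball.
    exact: measurable_funTS.
  - by move=> h _; rewrite patchE; case: ifP.
  - by rewrite lee_fin powR_ge0.
have T : (\int[leb]_t \int[mu]_h G (h, t) = \int[mu]_h \int[leb]_t G (h, t))%E.
  by rewrite -fubini_tonelli.
have mOb : measurable_fun setT (fun h => (O h * (eucl_norm h `^ (- b))%:E)%E).
  apply: emeasurable_funM => //; apply/measurable_EFinP.
  exact: (measurableT_comp (measurable_powR _) (@measurable_eucl_norm R n)).
rewrite L T -(ge0_integralZl mu measurableT mOb); last 2 first.
- by move=> h _; rewrite mule_ge0// lee_fin powR_ge0.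
- by rewrite lee_fin invr_ge0 ltW.
apply: ge0_le_integral => //.
- by move=> h _; apply: integral_ge0 => t _; exact: G0.
- exact: measurable_fun_fubini_tonelli_F.
- exact: emeasurable_funM.
move=> h _.
have -> : (\int[leb]_t G (h, t) = O h * \int[leb]_(t in `[c, d]) (w h t)%:E)%E.
  rewrite [X in (_ * X)%E]integral_mkcond -ge0_integralZl//.
  - apply: eq_integral => t _; rewrite /G/= patchE.
    have IE : \1_(`[c, d]%classic : set R) t = (t \in `[c, d]%classic)%:R :> R by rewrite indicE.
    by rewrite IE; case: ifP => _; rewrite ?mulr1// mulr0 !mule0.
  - by apply/(measurable_restrictT _ _).1 => //; exact: measurable_funTS.
  - by move=> t _; rewrite patchE; case: ifP => // _; rewrite lee_fin.
have [->|h0] := eqVneq h 0; first by rewrite O00 !mul0e mule0.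
have eh0 : 0 < eucl_norm h by rewrite lt_def eucl_norm_eq0 h0 eucl_norm_ge0.
rewrite muleCA lee_wpmul2l//.
apply: le_trans (integral_powR_tail c d b0 eh0) _.
by rewrite -EFinM lee_fin mulrC.
Qed.

(** The substitution x = y + h, then Tonelli. *)
Lemma gagliardo_integralE (b p : R) (u : 'rV[R]_n -> R) : measurable_fun setT u ->
  (\int[mu]_y \int[mu]_x ((`|u x - u y| `^ p) / (eucl_norm (x - y) `^ b))%:E =
   \int[mu]_h (modulus_pow p u h * (eucl_norm h `^ (- b))%:E))%E.
Proof.
move=> mu_.
pose H (z : 'rV[R]_n * 'rV[R]_n) :=
  ((`|u (z.2 + z.1)%R - u z.2| `^ p)%:E * (eucl_norm z.1 `^ (- b))%:E)%E.
have H0 z : (0 <= H z)%E by rewrite mule_ge0// lee_fin powR_ge0.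
have mH : measurable_fun setT H.
  apply: emeasurable_funM; first exact: measurable_powR_diff2.
  apply/measurable_EFinP; apply: (measurableT_comp (measurable_powR _)).
  exact: (measurableT_comp (@measurable_eucl_norm R n)).
transitivity (\int[mu]_y \int[mu]_h H (h, y))%E.
  apply: eq_integral => y _; rewrite -(ge0_integral_rV_addr y).
  - apply: eq_integral => h _.
    by rewrite /H/= -EFinM powRN addrK (addrC y).
  - apply/measurable_EFinP; apply: measurable_funM.
      apply: (measurableT_comp (measurable_powR _)).
      by apply: measurableT_comp => //; exact: measurable_funB.
    under eq_fun do rewrite -powRN.
    apply: (measurableT_comp (measurable_powR _)).
    exact: (measurableT_comp (@measurable_eucl_norm R n) (measurable_addrV (- y))).
  - by move=> x; rewrite lee_fin divr_ge0// powR_ge0.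
rewrite -(fubini_tonelli H)//; apply: eq_integral => h _.
rewrite -ge0_integralZr//.
- exact: measurable_powR_diff.
- by rewrite lee_fin powR_ge0.
Qed.

Lemma modulus_pow0 (p : R) (u : 'rV[R]_n -> R) : 1 <= p -> modulus_pow p u 0 = 0%E.
Proof.
move=> p1; apply: integral0_eq => x _.
by rewrite addr0 subrr normr0 powR0// gt_eqF// (lt_le_trans _ p1).
Qed.

(** Multiply [modulus_pow_ball] by t^(-n-sp-1) and integrate over t: the left-hand side
is evaluated by [integral_min_powR], the right-hand side is bounded by [layer_cake_le]
with b = n + sp. The layer cake formula yields a factor b, of which only n is kept. Each
th < 1 gives the inequality up to the factor th; then th tends to 1. *)
Lemma modulus_pow_gagliardo (s p : R) (u : 'rV[R]_n -> R) (y : 'rV[R]_n) :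
  0 < s < 1 -> 1 <= p -> measurable_fun setT u -> (0 < n)%N -> 0 < eucl_norm y ->
  ((n%:R * omega R n * (eucl_norm y `^ (- (s * p)) / (p * s * (1 - s))))%:E
     * modulus_pow p u y <=
   ((4 * (n%:R + 1)) `^ p)%:E *
     \int[mu]_h (modulus_pow p u h * (eucl_norm h `^ (- (n%:R + s * p)))%:E))%E.
Proof.
move=> s01 p1 mu_ n0 y0; have /andP[s0 s1] := s01; have p0 : 0 < p by lra.
have om0 := @omega_gt0 R n.
set K := (4 * (n%:R + 1)) `^ p; have K0 : 0 <= K by exact: powR_ge0.
set b := n%:R + s * p; have nR0 : (0 : R) < n%:R by rewrite ltr0n.
have b0 : 0 < b by rewrite addr_gt0// mulr_gt0.
set rho := eucl_norm y.
have mO := measurable_modulus_pow p mu_.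
have O0 := modulus_pow_ge0 p u.
have O00 := modulus_pow0 u p1.
have avg t : 0 < t -> ((t ^+ n * omega R n * minr (t / rho) 1 `^ p)%:E * modulus_pow p u y <=
   K%:E * \int[mu]_(h in eucl_ball 0 t) modulus_pow p u h)%E.
  by move=> t0; exact: modulus_pow_ball.
move: (modulus_pow p u) mO O0 O00 avg => O mO O0 O00 avg.
set X := rho `^ (- (s * p)) / (p * s * (1 - s)).
have X0 : 0 <= X by rewrite divr_ge0 ?powR_ge0// !mulr_ge0// ?ltW// subr_gt0.
apply/lee_mul01Pr => [|th th01].
  by rewrite mule_ge0// lee_fin (mulr_ge0 _ X0)// mulr_ge0// ltW.
have [c [d [c0 cd J]]] := integral_min_powR s01 p1 y0 th01.
have LC := layer_cake_le c d mO O0 O00 b0.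
set I := (\int[mu]_h _)%E in LC *.
pose f (t : R) := t `^ (- (s * p) - 1) * minr (t / rho) 1 `^ p.
have f0 t : 0 <= f t by rewrite mulr_ge0// powR_ge0.
have mf : measurable_fun setT f.
  apply: measurable_funM; first exact: measurable_powR.
  apply: (measurableT_comp (measurable_powR _)).
  by apply: measurable_minr => //; exact: measurable_funM.
apply: (@le_trans _ _ (b%:E * (K%:E * \int[leb]_(t in `[c, d])
     ((t `^ (- b - 1))%:E * \int[mu]_(h in eucl_ball 0%R t) O h)))%E); last first.
  rewrite muleCA lee_wpmul2l ?lee_fin//.
  by rewrite -lee_pdivlMl//.
have mA := measurable_ball_integral mO O0.
have A0 t : (0 <= \int[mu]_(h in eucl_ball 0%R t) O h)%E by apply: integral_ge0.
rewrite -(@ge0_integralZl _ _ _ leb _ (measurable_itv `[c, d])); last 3 first.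
- apply: measurable_funTS; apply: emeasurable_funM => //.
  by apply/measurable_EFinP; exact: measurable_powR.
- by move=> t _; rewrite mule_ge0// lee_fin powR_ge0.
- by rewrite lee_fin.
apply: (@le_trans _ _ (b%:E * \int[leb]_(t in `[c, d])
    ((omega R n)%:E * O y * (f t)%:E))%E); last first.
  rewrite lee_wpmul2l ?lee_fin ?(ltW b0)//.
  apply: ge0_le_integral => //.
  - by move=> t _; rewrite !mule_ge0// lee_fin ?f0// ltW.
  - apply: measurable_funTS; apply: emeasurable_funM => //.
    exact/measurable_EFinP.
  - apply: measurable_funTS; apply: emeasurable_funM => //.
    apply: emeasurable_funM => //.
    by apply/measurable_EFinP; exact: measurable_powR.
  move=> t; rewrite /= in_itv/= => /andP[ct _].
  have t0 : 0 < t by exact: lt_le_trans ct.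
  rewrite muleCA.
  apply: le_trans (lee_wpmul2l _ (avg t t0)); last by rewrite lee_fin powR_ge0.
  rewrite muleA -EFinM muleAC -EFinM.
  rewrite [leLHS](_ : _ = (t `^ (- b - 1) *
    (t ^+ n * omega R n * minr (t / rho) 1 `^ p))%:E * O y)%E//.
  congr (_%:E * _)%E; rewrite /f.
  have -> : t `^ (- (s * p) - 1) = t `^ (- b - 1) * t ^+ n.
    rewrite -powR_mulrn ?(ltW t0)// -powRD; last by rewrite (gt_eqF t0) implybT.
    by congr (_ `^ _); rewrite /b; ring.
  by ring.
rewrite ge0_integralZl//; last first.
- by rewrite mule_ge0// lee_fin ltW.
- by move=> t _; rewrite lee_fin.
- by apply: measurable_funTS; exact/measurable_EFinP.
apply: (@le_trans _ _ (b%:E * ((omega R n)%:E * O y * (th * X)%:E))%E); last first.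
  rewrite lee_wpmul2l ?lee_fin ?(ltW b0)// lee_wpmul2l//.
  by rewrite mule_ge0// lee_fin ltW.
rewrite !muleA -EFinM muleAC -!EFinM lee_wpmul2r// lee_fin.
have /andP[th0 _] := th01.
rewrite mulrCA.
apply: ler_wpM2r; first by rewrite mulr_ge0// ltW.
apply: ler_wpM2r; first by rewrite ltW.
by rewrite lerDl mulr_ge0// ltW.
Qed.

End layer_cake.

(** * Fractional smoothness *)

(** The measure of a null set of the product is the integral of the measures of its
sections, so almost every section is null. *)
Lemma ae_product d1 d2 (T1 : measurableType d1) (T2 : measurableType d2) (R : realType)
    (m1 : {sigma_finite_measure set T1 -> \bar R})
    (m2 : {sigma_finite_measure set T2 -> \bar R}) (P : T1 * T2 -> Prop) :
  (\forall z \ae (m1 \x m2)%E, P z) -> \forall x \ae m1, \forall y \ae m2, P (x, y).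
Proof.
move=> [N [mN N0 PN]].
have mx := measurable_fun_xsection m2 mN.
have /(ae_eq_integral_abs m1 measurableT mx).1 H : (\int[m1]_x `|(m2 \o xsection N) x| = 0)%E.
  by rewrite -[RHS]N0; apply: eq_integral => x _; rewrite gee0_abs.
apply: filterS H => x /(_ I)/= Nx0.
exists (xsection N x); split => //; first exact: measurable_xsection.
move=> y /= Py; rewrite /xsection/= inE; exact: PN.
Qed.

Section fractional.
Context {R : realType} {n : nat}.
Local Notation mu := (@lebesgue_rV R n).
Implicit Types (u : 'rV[R]_n -> R) (y : 'rV[R]_n) (s p : R).

(** ln z <= z / e, at z = p / a. The bound does not depend on p. *)
Lemma powR_inv_le_exp (p a : R) : 0 < p -> 0 < a ->
  (p / a) `^ p^-1 <= expR (1 / (expR 1 * a)).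
Proof.
move=> p0 a0; have pa0 : 0 < p / a by rewrite divr_gt0.
have e0 := expR_gt0 (1 : R).
rewrite /powR gt_eqF// ler_expR.
have : ln (p / a) <= (p / a) / expR 1.
  have := expR_ge1Dx (ln (p / a) - 1).
  by rewrite addrC subrK expRB lnK// posrE.
rewrite -(ler_pM2l (_ : 0 < p^-1)) ?invr_gt0// => /le_trans; apply.
by rewrite le_eqVlt; apply/orP; left; apply/eqP; field; rewrite !gt_eqF.
Qed.

(** The p-th root of [modulus_pow_gagliardo]. *)
Lemma modulus_gagliardo s p u y : (0 < n)%N -> 0 < s < 1 -> 1 <= p ->
  measurable_fun setT u ->
  (modulus p%:E u y <=
   (4 * (n%:R + 1) * expR (1 / (expR 1 * omega R n * n%:R)))%:E
    * gagliardo s p u * (eucl_norm y `^ s)%:E)%E.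
Proof.
move=> n0 s01 p1 mu_; have /andP[s0 s1] := s01; have p0 : 0 < p by lra.
have nR0 : (0 : R) < n%:R by rewrite ltr0n.
have om0 := @omega_gt0 R n.
have pV0 : 0 <= p^-1 by rewrite invr_ge0 ltW.
have G0 : (0 <= gagliardo s p u)%E by exact: poweR_ge0.
have K0 : 0 < 4 * (n%:R + 1) :> R by lra.
have [->|yN0] := eqVneq y 0.
  rewrite modulus0//; apply: mule_ge0; last by rewrite lee_fin powR_ge0.
  by apply: mule_ge0 => //; rewrite lee_fin mulr_ge0 ?expR_ge0// ltW.
have y0 : 0 < eucl_norm y by rewrite lt_def eucl_norm_eq0 yN0 eucl_norm_ge0.
have key := modulus_pow_gagliardo s01 p1 mu_ n0 y0.
rewrite -(gagliardo_integralE _ _ mu_) in key.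
rewrite /gagliardo; set I := (\int[mu]_y0 _)%E in key *.
have I0 : (0 <= I)%E.
  by apply: integral_ge0 => z _; apply: integral_ge0 => x _;
    rewrite lee_fin divr_ge0// powR_ge0.
set K := 4 * (n%:R + 1) in key K0 *; set rho := eucl_norm y in key y0 *.
have ss0 : 0 < s * (1 - s) by rewrite mulr_gt0// subr_gt0.
have M0 : (0 <= modulus p%:E u y)%E by exact: modulus_ge0.
have H : (modulus p%:E u y `^ p <=
    (K `^ p * (p / (omega R n * n%:R)) * rho `^ (s * p))%:E * ((s * (1 - s))%:E * I))%E.
  rewrite modulus_powE//.
  have c0 : 0 < n%:R * omega R n * (rho `^ (- (s * p)) / (p * s * (1 - s))).
    by rewrite !mulr_gt0// ?invr_gt0 ?powR_gt0// -mulrA mulr_gt0.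
  move: key; rewrite -lee_pdivlMl// => /le_trans; apply.
  rewrite !muleA -!EFinM lee_wpmul2r// lee_fin powRN.
  have rn0 : rho `^ (s * p) != 0 by rewrite gt_eqF// powR_gt0.
  rewrite le_eqVlt; apply/orP; left; apply/eqP; field.
  by rewrite rn0 !gt_eqF// subr_gt0.
have -> : modulus p%:E u y = ((modulus p%:E u y `^ p) `^ p^-1)%E.
  by rewrite -poweRrM divff ?gt_eqF// poweRe1.
apply: (le_trans (le_poweR pV0 (poweR_ge0 _ _) H)).
have pn0 : 0 <= p / (omega R n * n%:R) by rewrite divr_ge0 ?ltW// mulr_gt0.
have Kp0 : 0 <= K `^ p * (p / (omega R n * n%:R)) by rewrite mulr_ge0// powR_ge0.
have rp0 : 0 <= rho `^ (s * p) by exact: powR_ge0.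
rewrite poweRM; last 2 first.
- by rewrite lee_fin mulr_ge0.
- by rewrite mule_ge0// lee_fin ltW.
rewrite poweR_EFin (powRM _ Kp0 rp0) (powRM _ (powR_ge0 _ _) pn0).
rewrite -!powRrM divff ?gt_eqF// powRr1 ?(ltW K0)// mulfK ?gt_eqF//.
rewrite [leRHS]muleAC -EFinM; apply: lee_wpmul2r; first exact: poweR_ge0.
rewrite lee_fin ler_wpM2r ?powR_ge0// ler_wpM2l ?(ltW K0)//.
by rewrite -(mulrA (expR 1)); apply: powR_inv_le_exp => //; rewrite mulr_gt0.
Qed.

Lemma hoelder_esssup_ge0 s u : (0 <= hoelder_esssup s u)%E.
Proof.
apply: ess_sup_gee; last by apply: nearW => z; rewrite lee_fin divr_ge0// powR_ge0.
rewrite [ltRHS](_ : _ = (mu setT * mu setT)%E); last by rewrite -product_measure1E// setXTT.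
by rewrite mule_gt0//; exact: lebesgue_rVT_gt0.
Qed.

(** The bound on |u x - u z| is only known for almost every pair, hence perhaps not for
the pairs (x, x + y). But for almost every x it holds at (x, z) and at (x + y, z) for
almost every z, hence for some z with |x - z| <= |y|. Then |x + y - z| <= 2 |y|, and the
constant is 2^s + 1 <= 3. *)
Lemma modulus_hoelder s u y : 0 < s < 1 -> measurable_fun setT u ->
  (hoelder_esssup s u < +oo)%E ->
  (modulus +oo%E u y <= 3%:E * hoelder_esssup s u * (eucl_norm y `^ s)%:E)%E.
Proof.
move=> /andP[s0 s1] mu_ Moo.
have M0 := hoelder_esssup_ge0 s u.
have [->|yN0] := eqVneq y 0.
  rewrite modulus0 ?leey// mule_ge0 ?lee_fin ?powR_ge0//.
  by apply: mule_ge0.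
have y0 : 0 < eucl_norm y by rewrite lt_def eucl_norm_eq0 yN0 eucl_norm_ge0.
have [M ME] : exists M : R, hoelder_esssup s u = M%:E.
  by exists (fine (hoelder_esssup s u)); rewrite fineK// ge0_fin_numE.
have := ess_sup_ge (mu \x mu)%E
    (fun z => (`|u z.1 - u z.2| / (eucl_norm (z.1 - z.2) `^ s))%:E).
rewrite -/(hoelder_esssup s u) ME => /ae_product H.
move: M0; rewrite ME lee_fin => M0.
have {}H : \forall x \ae mu, \forall z \ae mu,
    `|u x - u z| <= M * eucl_norm (x - z) `^ s.
  apply: filterS H => x; apply: filterS => z /=; rewrite lee_fin.
  have [->|xz] := eqVneq x z; first by rewrite !subrr normr0 mulr_ge0 ?powR_ge0.
  rewrite ler_pdivrMr// powR_gt0// lt_def eucl_norm_eq0 eucl_norm_ge0 andbT.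
  by rewrite subr_eq0.
(* Good points z fill the ball of centre x and radius |y| up to a null set. *)
rewrite /modulus unlock lebesgue_rVT_gt0.
apply/ess_supP; have Hy := ae_shift y H.
apply: filterS2 H Hy => x Hx Hxy /=.
have [z [zy [Pz Qz]]] : exists z, eucl_norm (x - z) <= eucl_norm y /\
   (`|u x - u z| <= M * eucl_norm (x - z) `^ s /\
    `|u (x + y) - u z| <= M * eucl_norm (x + y - z) `^ s).
  have [N [mN N0 HN]] := filterI Hx Hxy.
  apply/not_existsP => Nz.
  have : (mu (eucl_ball x (eucl_norm y)) <= mu N)%E.
    apply: le_measure; rewrite ?inE//; first exact: measurable_eucl_ball.
    move=> z xz; apply: HN => /= PQ; apply: (Nz z); split => //.
    by rewrite -opprB eucl_normN.
  rewrite [leRHS](_ : _ = 0%E)// lebesgue_eucl_ball// lee_fin leNgt mulr_gt0//.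
    by rewrite exprn_gt0.
  exact: omega_gt0.
rewrite -EFinM lee_fin; clear Hx Hxy Moo ME.
apply: (@le_trans _ _ (M * eucl_norm (x + y - z) `^ s + M * eucl_norm (x - z) `^ s)).
  rewrite (_ : u (x + y) - u x = (u (x + y) - u z) - (u x - u z)); last by ring.
  by rewrite (le_trans (ler_normB _ _))// lerD.
rewrite -mulrDr (mulrC 3) -mulrA ler_wpM2l//.
have -> : (3 : R) * eucl_norm y `^ s = 2 * eucl_norm y `^ s + eucl_norm y `^ s by ring.
apply: lerD; last by apply: ge0_ler_powR; rewrite ?nnegrE ?eucl_norm_ge0// ltW.
apply: (@le_trans _ _ ((2 * eucl_norm y) `^ s)).
  apply: ge0_ler_powR; rewrite ?nnegrE ?mulr_ge0 ?eucl_norm_ge0// ?(ltW s0)//.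
  rewrite addrAC (le_trans (eucl_normD _ _))// mulr2n mulrDl mul1r lerD//.
rewrite powRM ?eucl_norm_ge0// ler_wpM2r ?powR_ge0//.
rewrite -[leRHS](@powRr1 _ 2)// ler_powR ?ler1n// ltW//.
Qed.

End fractional.

(** * Smooth flat functions *)

Section flat.
Context {R : realType}.
Implicit Types (P Q : {poly R}) (t : R).

(** The derivatives of exp(-1/t) for t > 0, extended by 0: differentiating
P(1/t) exp(-1/t) replaces P by X^2 (P - P'). *)
Definition flat_exp P t : R := if 0 < t then P.[t^-1] * expR (- t^-1) else 0.

(** exp(1/t) is the (m+1)-st power of exp(1/((m+1) t)), and exp z >= z. *)
Lemma expRN_inv_le m t : 0 < t -> expR (- t^-1) <= m.+1%:R ^+ m.+1 * t ^+ m.+1.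
Proof.
move=> t0; rewrite expRN -exprMn.
have mt : 0 < m.+1%:R * t by rewrite mulr_gt0.
rewrite -[leRHS]invrK lef_pV2 ?posrE ?invr_gt0 ?exprn_gt0 ?expR_gt0//.
have -> : t^-1 = m.+1%:R * (m.+1%:R * t)^-1.
  by rewrite invfM mulrA divff ?mul1r ?pnatr_eq0.
rewrite expRM_natl -exprVn lerXn2r ?nnegrE ?expR_ge0// ?invr_ge0 ?(ltW mt)//.
by apply: le_trans (expR_ge1Dx _); rewrite lerDr.
Qed.

(** A factor 1/t costs one order of vanishing at 0, and exp(-1/t) vanishes to every
order: induction on P, for all m at once. *)
Lemma flat_exp_bound P m : exists2 C, 0 <= C &
  forall t, `|t| <= 1 -> `|flat_exp P t| <= C * `|t| ^+ m.+1.
Proof.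
elim/poly_ind: P m => [|P c IH] m.
  exists 0 => // t _; rewrite /flat_exp; case: ifP => _; last by rewrite normr0 mul0r.
  by rewrite horner0 mul0r normr0 mul0r.
have [C C0 HC] := IH m.+1.
exists (C + `|c| * m.+1%:R ^+ m.+1); first by rewrite addr_ge0// mulr_ge0// exprn_ge0.
move=> t t1; have := HC t t1; rewrite /flat_exp; case: ifPn => t0; last first.
  by rewrite normr0 => _; rewrite mulr_ge0 ?exprn_ge0// addr_ge0// mulr_ge0// exprn_ge0.
move=> H; rewrite hornerMXaddC mulrDl (le_trans (ler_normD _ _))// mulrDl lerD//.
  rewrite mulrAC normrM normfV -ler_pdivlMr ?invr_gt0 ?normr_gt0 ?gt_eqF// invrK.
  by apply: (le_trans H); rewrite [in leRHS]mulrC mulrCA mulrA -mulrA -exprS mulrC.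
rewrite normrM -mulrA ler_wpM2l// ger0_norm ?expR_ge0// gtr0_norm//.
exact: expRN_inv_le.
Qed.

(** At t = 0 the difference quotient tends to 0 because the function is O(t^2). *)
Lemma is_derive_flat_exp P t :
  is_derive t 1 (flat_exp P) (flat_exp ('X^2 * (P - P^`())) t).
Proof.
have [t0|t0|->] := ltgtP t 0.
- have -> : flat_exp ('X^2 * (P - P^`())) t = 0 by rewrite /flat_exp ltNge (ltW t0).
  apply: (@near_eq_is_derive _ _ _ (cst 0)).
  near=> x; rewrite /flat_exp ltNge (_ : x <= 0)//.
  by apply: ltW; near: x; exact: lt_nbhsl.
- have tN0 : t != 0 by rewrite gt_eqF.
  have dV : is_derive t 1 (fun x : R => x^-1) (- t ^- 2).
    have := @is_deriveV _ id t 1 1 tN0 (is_derive_id _ _).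
    by move=> H; apply: is_derive_eq; rewrite /GRing.scale/= mulr1.
  have dP : is_derive t 1 (fun x => P.[x^-1]) (P^`().[t^-1] * - t ^- 2).
    exact: (@is_derive1_comp _ (horner P) (fun x => x^-1)).
  have dE : is_derive t 1 (fun x => expR (- x^-1)) (expR (- t^-1) * t ^- 2).
    have dN : is_derive t 1 (fun x : R => - x^-1) (t ^- 2).
      by have := is_deriveN dV; rewrite opprK.
    exact: (@is_derive1_comp _ expR (fun x => - x^-1)).
  have := is_deriveM dP dE.
  rewrite (_ : _ + _ = flat_exp ('X^2 * (P - P^`())) t); last first.
    by rewrite /flat_exp t0 !hornerE /= /GRing.scale/=; field.
  apply: near_eq_is_derive; near=> x; rewrite /flat_exp (_ : 0 < x)//.
  by near: x; exact: lt_nbhsr.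
- have -> : flat_exp ('X^2 * (P - P^`())) 0 = 0 by rewrite /flat_exp ltxx.
  have [C C0 HC] := flat_exp_bound P 1.
  have H : h^-1 *: ((flat_exp P \o shift 0) (h *: 1) - flat_exp P 0) @[h --> 0^'] --> (0 : R).
    apply/cvgr0Pnorm_le => e e0.
    have eC0 : 0 < e / (C + 1) by rewrite divr_gt0// ltr_wpDl.
    near=> h.
    have h1 : `|h| <= 1 by near: h; exact: dnbhs0_le.
    have he : `|h| <= e / (C + 1) by near: h; exact: dnbhs0_le.
    have hN0 : h != 0 by near: h; exact: nbhs_dnbhs_neq.
    rewrite /= addr0 [h *: 1]mulr1 {2}/flat_exp ltxx subr0 normrZ normfV.
    rewrite ler_pdivrMl ?normr_gt0//.
    apply: (le_trans (HC h h1)); rewrite expr2 mulrCA ler_wpM2l//.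
    apply: (@le_trans _ _ ((C + 1) * `|h|)); first by rewrite ler_wpM2r// lerDl.
    by rewrite mulrC -ler_pdivlMr// ltr_wpDl.
  apply: DeriveDef; first by apply/cvg_ex; exists 0.
  exact: cvg_lim.
Unshelve. all: by end_near. Qed.

End flat.

Section test_functions.
Context {R : realType} {n : nat}.
Implicit Types (f g : 'rV[R]_n -> R) (x v : 'rV[R]_n).
Local Notation mu := (@lebesgue_rV R n).

(** Closed under partial derivatives ([derive_flat_alg]), hence made of smooth functions;
an inductive predicate, so that this and the other closure properties are plain
inductions. *)
Inductive flat_alg : ('rV[R]_n -> R) -> Prop :=
| flat_alg_exp P c a i : flat_alg (fun x => flat_exp P (c * x ord0 i + a))
| flat_alg_cst c : flat_alg (cst c)
| flat_algD f g : flat_alg f -> flat_alg g -> flat_alg (f + g)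
| flat_algM f g : flat_alg f -> flat_alg g -> flat_alg (f * g).

Lemma differentiable_flat_exp P (t : R) : differentiable (flat_exp P) t.
Proof.
by apply/derivable1_diffP; exact: (@ex_derive _ _ _ _ _ _ _ (is_derive_flat_exp P t)).
Qed.

Lemma differentiable_affine_coord (c a : R) i x :
  differentiable (fun x : 'rV[R]_n => c * x ord0 i + a : R) x.
Proof.
apply: (@differentiableD _ _ _ (fun x : 'rV[R]_n => c * x ord0 i) (cst a)) => //.
apply: (@differentiableM _ _ (cst c) (fun x : 'rV[R]_n => x ord0 i)) => //.
exact: differentiable_coord.
Qed.

Lemma differentiable_flat_alg f x : flat_alg f -> differentiable f x.
Proof.
move=> F; elim: F x => {f} [P c a i|c|f g _ df _ dg|f g _ df _ dg] x.
- apply: (@differentiable_comp _ _ _ _ (fun x : 'rV[R]_n => c * x ord0 i + a) (flat_exp P)).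
    exact: differentiable_affine_coord.
  exact: differentiable_flat_exp.
- exact: differentiable_cst.
- exact: differentiableD.
- exact: differentiableM.
Qed.

Lemma derive_flat_alg f v : flat_alg f -> flat_alg ('D_v f).
Proof.
elim => {f} [P c a i|c|f g Ff Df Fg Dg|f g Ff Df Fg Dg].
- rewrite (_ : 'D_v _ = (cst (c * v ord0 i)) *
     (fun x => flat_exp ('X^2 * (P - P^`())) (c * x ord0 i + a))).
    by apply: flat_algM; constructor.
  apply/funext => x.
  have dA := differentiable_affine_coord c a i x.
  have dF := differentiable_flat_exp P (c * x ord0 i + a).
  rewrite deriveE; last exact: differentiable_flat_alg (flat_alg_exp P c a i).
  rewrite (@diff_comp _ _ _ _ (fun x : 'rV[R]_n => c * x ord0 i + a) (flat_exp P))//=.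
  have -> : 'd (fun x : 'rV[R]_n => c * x ord0 i + a) x v = c * v ord0 i.
    rewrite -deriveE//.
    have dX : is_derive x v (fun x : 'rV[R]_n => x ord0 i) (v ord0 i).
      apply: DeriveDef; first by apply: diff_derivable; exact: differentiable_coord.
      by rewrite -[v in RHS](derive_id x) derive_mx// mxE.
    have -> : (fun x : 'rV[R]_n => c * x ord0 i + a) =
        c \*: (fun x : 'rV[R]_n => x ord0 i) + cst a by [].
    by rewrite derive_val addr0.
  rewrite -[X in 'd _ _ X]mulr1 linearZ/= -deriveE//.
  by rewrite (@derive_val _ _ _ _ _ _ _ (is_derive_flat_exp P _)).
- rewrite (_ : 'D_v _ = cst 0); first by constructor.
  by apply/funext => x; rewrite derive_cst.
- rewrite (_ : 'D_v _ = 'D_v f + 'D_v g); first by constructor.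
  by apply/funext => x; rewrite deriveD//; apply: diff_derivable; exact: differentiable_flat_alg.
- rewrite (_ : 'D_v _ = f * 'D_v g + g * 'D_v f).
    by apply: flat_algD; exact: flat_algM.
  by apply/funext => x; rewrite deriveM//; apply: diff_derivable; exact: differentiable_flat_alg.
Qed.

Lemma continuous_flat_alg f : flat_alg f -> continuous f.
Proof. by move=> F x; apply: differentiable_continuous; exact: differentiable_flat_alg. Qed.

Lemma measurable_flat_alg f : flat_alg f -> measurable_fun setT f.
Proof.
elim => {f} [P c a i|c|f g _ mf _ mg|f g _ mf _ mg].
- apply: measurableT_comp.
    apply: continuous_measurable_fun => t.
    by apply: differentiable_continuous; exact: differentiable_flat_exp.
  apply: measurable_funD => //; apply: measurable_funM => //.
  exact: measurable_coord_rV.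
- exact: measurable_cst.
- exact: measurable_funD.
- exact: measurable_funM.
Qed.

Lemma smooth_flat_alg f : flat_alg f -> smooth f.
Proof.
move=> F l; have {}F : flat_alg (iter_partial l f).
  by elim: l => [|i l IH] //=; exact: derive_flat_alg.
split; first exact: continuous_flat_alg.
by move=> x i; apply: diff_derivable; exact: differentiable_flat_alg.
Qed.

Lemma compact_box (a b : 'I_n -> R) : compact [set x : 'rV[R]_n | forall i, `[a i, b i]%classic (x ord0 i)].
Proof. by apply: (@rV_compact _ n (fun i => `[a i, b i]%classic)) => i; exact: segment_compact. Qed.

Lemma test_function_flat_alg f (a b : 'I_n -> R) : flat_alg f ->
  (forall x, f x != 0 -> open_box a b x) -> test_function f.
Proof.
move=> F fab; split; first exact: smooth_flat_alg.
have cK := @compact_box a b.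
apply: (subclosed_compact _ cK); first exact: closed_closure.
have clK := compact_closed (@norm_hausdorff _ 'rV[R]_n) cK.
rewrite [X in _ `<=` X]((closure_id _).1 clK); apply: closureS => x /= /fab xab i.
by have := xab i; rewrite /= !in_itv/= => /andP[/ltW -> /ltW ->].
Qed.

End test_functions.

(** * Bumps on boxes and the fundamental lemma *)

Section box_bump.
Context {R : realType} {n : nat}.
Implicit Types (a b : 'I_n -> R) (x v : 'rV[R]_n) (k : nat).
Local Notation mu := (@lebesgue_rV R n).

(** Inside the box the value is exp(- S(x) / (k + 1)), where S(x) is the sum of the
inverses of the distances from x to the hyperplanes of the faces; so the bumps tend to the
indicator of the box. *)
Definition box_bump k a b x : R := \prod_(i < n)
  (flat_exp 1 (k.+1%:R * x ord0 i + - (k.+1%:R * a i)) *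
   flat_exp 1 (- k.+1%:R * x ord0 i + k.+1%:R * b i)).

Lemma flat_alg_prod (F : 'I_n -> 'rV[R]_n -> R) :
  (forall i, flat_alg (F i)) -> flat_alg (fun x => \prod_(i < n) F i x).
Proof.
move=> HF; elim: (index_enum _) => [|i r IH].
  rewrite (_ : (fun _ => _) = cst 1); first by constructor.
  by apply/funext => x; rewrite big_nil.
rewrite (_ : (fun _ => _) = F i * (fun x => \prod_(j <- r) F j x)).
  exact: flat_algM.
by apply/funext => x; rewrite big_cons.
Qed.

Lemma flat_alg_bump k a b : flat_alg (box_bump k a b).
Proof.
apply: flat_alg_prod => i.
exact: (flat_algM (flat_alg_exp _ _ _ _) (flat_alg_exp _ _ _ _)).
Qed.

Lemma flat_exp1_itv (t : R) : 0 <= flat_exp 1 t <= 1.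
Proof.
rewrite /flat_exp; case: ifPn => t0; last by rewrite lexx ler01.
rewrite hornerE mul1r expR_ge0/= -expR0 ler_expR oppr_le0 invr_ge0.
exact: ltW.
Qed.

Lemma bump_itv k a b x : 0 <= box_bump k a b x <= 1.
Proof.
rewrite /box_bump; elim/big_ind : _ => [|s t /andP[? ?] /andP[? ?]|i _].
- by rewrite ler01 lexx.
- by rewrite mulr_ge0//= mulr_ile1.
- have /andP[? ?] := flat_exp1_itv (k.+1%:R * x ord0 i + - (k.+1%:R * a i)).
  have /andP[? ?] := flat_exp1_itv (- k.+1%:R * x ord0 i + k.+1%:R * b i).
  by rewrite mulr_ge0//= mulr_ile1.
Qed.

Lemma bump_neq0 k a b x : box_bump k a b x != 0 -> open_box a b x.
Proof.
move=> /prodf_neq0 H i; have := H i isT.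
rewrite mulf_eq0 negb_or /flat_exp => /andP[].
have k0 : 0 < k.+1%:R :> R by [].
case: ifPn; last by rewrite eqxx.
rewrite subr_gt0 ltr_pM2l// => xa _.
case: ifPn; last by rewrite eqxx.
by rewrite mulNr addrC subr_gt0 ltr_pM2l// => xb _; rewrite /= in_itv/= xa.
Qed.

Lemma bump_out k a b x : ~ open_box a b x -> box_bump k a b x = 0.
Proof. by move=> xab; apply/eqP/negP => /negP /bump_neq0. Qed.

Lemma cvg_bump a b x : open_box a b x -> box_bump k a b x @[k --> \oo] --> (1 : R).
Proof.
move=> xab.
pose S := \sum_(i < n) ((x ord0 i - a i)^-1 + (b i - x ord0 i)^-1).
rewrite (_ : (fun k => _) = fun k => expR (- (harmonic k * S))).
  rewrite -expR0; apply: continuous_cvg; first exact: continuous_expR.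
  rewrite -[X in _ --> X]oppr0 -(mul0r S); apply: cvgN; apply: cvgMl; exact: cvg_harmonic.
apply/funext => k; rewrite /S mulr_sumr -sumrN expR_sum; apply: eq_bigr => i _.
have k0 : 0 < k.+1%:R :> R by [].
have /= := xab i; rewrite in_itv/= => /andP[ax xb].
rewrite /flat_exp mulNr (addrC (- _)) -!mulrBr !pmulr_rgt0// !subr_gt0 ax xb !hornerE.
by rewrite /= ?mulr1 ?mul1r -expRD !invfM -opprD -mulrDr.
Qed.

Lemma sub_box_cube a b : exists r : R, open_box a b `<=` open_box (fun=> - r) (fun=> r).
Proof.
exists (\sum_i (`|a i| + `|b i|)) => x xab i; have := xab i.
rewrite /= !in_itv/= => /andP[ax xb].
have : `|a i| + `|b i| <= \sum_j (`|a j| + `|b j|).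
  by rewrite (bigD1 i)//= lerDl sumr_ge0// => j _; rewrite addr_ge0.
have := ler_norm (b i); have := ler_norm (- a i); rewrite normrN.
have := normr_ge0 (a i); have := normr_ge0 (b i).
by move=> *; apply/andP; split; lra.
Qed.

Lemma cvg_integral_bump (f : 'rV[R]_n -> \bar R) a b :
  mu.-integrable (open_box a b) f ->
  (\int[mu]_x (f x * (box_bump k a b x)%:E))%E @[k --> \oo] -->
  (\int[mu]_(x in open_box a b) f x)%E.
Proof.
move=> intf; have mB := measurable_open_box a b.
have mf := measurable_int _ intf.
have mfk k : measurable_fun (open_box a b) (fun x => f x * (box_bump k a b x)%:E)%E.
  apply: emeasurable_funM => //; apply/measurable_EFinP; apply: measurable_funTS.
  exact: measurable_flat_alg (flat_alg_bump k a b).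
have cvgf : \forall x \ae mu, open_box a b x ->
    (f x * (box_bump k a b x)%:E)%E @[k --> \oo] --> f x.
  apply: filterS (integrable_ae mB intf) => x /= fx xab.
  rewrite -(fineK (fx xab)) -[X in _ --> X]mule1.
  apply: cvgeM => //; first exact: cvg_cst.
  by apply: cvg_EFin; [exact: nearW|exact: cvg_bump].
have domf : \forall x \ae mu, forall k, open_box a b x ->
    (`|f x * (box_bump k a b x)%:E| <= (abse \o f) x)%E.
  apply: nearW => x k _; have /andP[b0 b1] := bump_itv k a b x.
  rewrite abseM /= ger0_norm// -[leRHS]mule1 lee_wpmul2l//.
have [_ _ H] := dominated_convergence mB mfk mf cvgf (integrable_abse intf) domf.
rewrite (_ : (fun k => _) = (fun k =>
    \int[mu]_(x in open_box a b) (f x * (box_bump k a b x)%:E))%E)//.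
apply/funext => k; rewrite [RHS]integral_mkcond; apply: eq_integral => x _.
rewrite patchE; case: ifPn => // /negP xab.
by rewrite bump_out ?mule0// => xab'; apply: xab; rewrite inE.
Qed.

Lemma measurable_cube (r : R) : measurable (@open_box R n (fun=> - r) (fun=> r)).
Proof. exact: measurable_open_box. Qed.

(** The fundamental lemma of the calculus of variations. As k tends to infinity, the
hypothesis says that f1 and f2 have the same integral over every open box. So the measures
of densities f1^+ + f2^- and f2^+ + f1^- agree on open boxes, hence everywhere; on subsets
of cubes, where all parts are integrable, this says that f1 and f2 have the same
integral. *)
Lemma ae_eq_bump (f1 f2 : 'rV[R]_n -> \bar R) :
  measurable_fun setT f1 -> measurable_fun setT f2 ->
  (forall r : R, mu.-integrable (open_box (fun=> - r) (fun=> r)) f1) ->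
  (forall r : R, mu.-integrable (open_box (fun=> - r) (fun=> r)) f2) ->
  (forall k a b, \int[mu]_x (f1 x * (box_bump k a b x)%:E) =
                 \int[mu]_x (f2 x * (box_bump k a b x)%:E))%E ->
  \forall x \ae mu, f1 x = f2 x.
Proof.
move=> mf1 mf2 if1 if2 f12.
have ib (f : 'rV[R]_n -> \bar R) : (forall r : R, mu.-integrable (open_box (fun=> - r) (fun=> r)) f) ->
    forall a b, mu.-integrable (open_box a b) f.
  move=> iF a b; have [r abr] := sub_box_cube a b.
  apply: integrableS abr (iF r); [exact: measurable_cube|exact: measurable_open_box].
have boxE a b : (\int[mu]_(x in open_box a b) f1 x = \int[mu]_(x in open_box a b) f2 x)%E.
  have c1 := cvg_integral_bump (ib _ if1 a b).
  have c2 := cvg_integral_bump (ib _ if2 a b).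
  move: c1; under eq_fun do rewrite f12.
  by move=> c1; rewrite -(cvg_lim _ c1)// -(cvg_lim _ c2).
have ex (f : 'rV[R]_n -> \bar R) : measurable_fun setT f -> (forall x, 0 <= f x)%E ->
    exists m : {measure set 'rV[R]_n -> \bar R}, forall A, m A = (\int[mu]_(x in A) f x)%E.
  move=> mf f0.
  pose m A := (\int[mu]_(x in A) f x)%E.
  have m0 : m set0 = 0%E by exact: integral_set0.
  have mge0 A : (0 <= m A)%E by exact: integral_ge0.
  have msa : semi_sigma_additive m by exact: semi_sigma_additive_nng_induced.
  pose mix := isMeasure.Build _ _ _ m m0 mge0 msa.
  pose M : {measure set 'rV[R]_n -> \bar R} := HB.pack m mix.
  by exists M.
(* Sums of parts rather than differences, so that both sides are measures. *)
pose h1 x := (f1^\+ x + f2^\- x)%E; pose h2 x := (f2^\+ x + f1^\- x)%E.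
have mp f : measurable_fun setT f -> measurable_fun setT (f^\+)%E := @measurable_funepos _ _ _ _ f.
have mn f : measurable_fun setT f -> measurable_fun setT (f^\-)%E := @measurable_funeneg _ _ _ _ f.
have mh1 : measurable_fun setT h1 by apply: emeasurable_funD; [exact: mp|exact: mn].
have mh2 : measurable_fun setT h2 by apply: emeasurable_funD; [exact: mp|exact: mn].
have [m1 m1E] := ex _ mh1 (fun x => adde_ge0 (funepos_ge0 f1 x) (funeneg_ge0 f2 x)).
have [m2 m2E] := ex _ mh2 (fun x => adde_ge0 (funepos_ge0 f2 x) (funeneg_ge0 f1 x)).
have split1 A : measurable A -> m1 A = (\int[mu]_(x in A) f1^\+ x + \int[mu]_(x in A) f2^\- x)%E.
  move=> mA; rewrite m1E ge0_integralD//; apply: measurable_funTS; [exact: mp|exact: mn].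
have split2 A : measurable A -> m2 A = (\int[mu]_(x in A) f2^\+ x + \int[mu]_(x in A) f1^\- x)%E.
  move=> mA; rewrite m2E ge0_integralD//; apply: measurable_funTS; [exact: mp|exact: mn].
have m12 A : measurable A -> m1 A = m2 A.
  apply: rV_measure_unique => [a b|r].
  - have mB := measurable_open_box a b.
    rewrite split1// split2//; have := boxE a b; rewrite integralE [RHS]integralE.
    have /fineK <- := integrable_pos_fin_num mB (ib _ if1 a b).
    have /fineK <- := integrable_neg_fin_num mB (ib _ if1 a b).
    have /fineK <- := integrable_pos_fin_num mB (ib _ if2 a b).
    have /fineK <- := integrable_neg_fin_num mB (ib _ if2 a b).
    by rewrite -!EFinB -!EFinD => -[E]; congr EFin; lra.
  - have mB := measurable_cube r.
    rewrite split1//.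
    have /fineK <- := integrable_pos_fin_num mB (if1 r).
    have /fineK <- := integrable_neg_fin_num mB (if2 r).
    by rewrite -EFinD ltry.
have aek (k : nat) : \forall x \ae mu, open_box (fun=> - k%:R) (fun=> k%:R) x -> f1 x = f2 x.
  have mK := measurable_cube k%:R.
  apply: (integral_ae_eq mK (if1 k%:R)); first exact: measurable_funTS.
  move=> E EK mE.
  have i1 := integrableS mK mE EK (if1 k%:R).
  have i2 := integrableS mK mE EK (if2 k%:R).
  rewrite [LHS]integralE [RHS]integralE; have := m12 E mE; rewrite split1// split2//.
  have /fineK <- := integrable_pos_fin_num mE i1.
  have /fineK <- := integrable_neg_fin_num mE i1.
  have /fineK <- := integrable_pos_fin_num mE i2.
  have /fineK <- := integrable_neg_fin_num mE i2.
  by rewrite -!EFinB -!EFinD => -[F]; congr EFin; lra.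
apply: filterS (ae_foralln aek) => x H.
apply: (H (Num.bound `|x|)) => j /=.
by rewrite in_itv/= -ltr_norml coord_lt_bound.
Qed.

End box_bump.

(** * Integrability along segments *)

Section bounds.
Context {R : realType} {n : nat}.
Implicit Types (x v w : 'rV[R]_n).
Local Notation mu := (@lebesgue_rV R n).
Local Notation leb := (@lebesgue_measure R).

Lemma flat_exp_bounded (P : {poly R}) : exists C, forall t, `|flat_exp P t| <= C.
Proof.
have [C1 C10 H1] := flat_exp_bound P 0.
have [C2 H2] : exists C, forall y : R, 0 <= y <= 1 -> `|P.[y]| <= C.
  elim/poly_ind: P {C1 C10 H1} => [|P c [C IH]].
    by exists 0 => y _; rewrite horner0 normr0.
  exists (C + `|c|) => y /[dup] y01 /andP[y0 y1].
  rewrite hornerMXaddC (le_trans (ler_normD _ _))// lerD//.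
  rewrite normrM (ger0_norm y0) (le_trans _ (IH y y01))//.
  by rewrite ler_piMr.
exists (maxr C1 C2) => t; have [t1|t1] := lerP `|t| 1.
  rewrite (le_trans (H1 t t1))// le_max; apply/orP; left.
  by rewrite expr1 ler_piMr.
rewrite le_max; apply/orP; right; rewrite /flat_exp.
have C20 : 0 <= C2 by apply: le_trans (H2 0 _); rewrite ?lexx ?ler01.
case: ifPn => t0; last by rewrite normr0.
have tV : 0 <= t^-1 <= 1.
  rewrite invr_ge0 (ltW t0)/= invf_le1// ltW//.
  by move: t1; rewrite gtr0_norm.
rewrite normrM (le_trans _ (H2 t^-1 tV))// ler_piMr// ger0_norm ?expR_ge0//.
by rewrite -expR0 ler_expR oppr_le0 invr_ge0 ltW.
Qed.

Lemma flat_alg_bounded (f : 'rV[R]_n -> R) : flat_alg f -> exists C, forall x, `|f x| <= C.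
Proof.
elim => {f} [P c a i|c|f g _ [C HC] _ [D HD]|f g _ [C HC] _ [D HD]].
- by have [C HC] := flat_exp_bounded P; exists C => x; exact: HC.
- by exists `|c|.
- by exists (C + D) => x; rewrite (le_trans (ler_normD _ _))// lerD.
- by exists (C * D) => x; rewrite normrM ler_pM.
Qed.

Lemma integral_rV_addr (h : 'rV[R]_n -> \bar R) v : measurable_fun setT h ->
  (\int[mu]_x h (x + v)%R = \int[mu]_x h x)%E.
Proof.
move=> mh; rewrite [LHS]integralE [RHS]integralE; congr (_ - _)%E.
  have := @ge0_integral_rV_addr R n v (h^\+)%E (measurable_funepos mh) (funepos_ge0 h).
  by move=> <-; apply: eq_integral => x _; rewrite ?funeposE ?funenegE.
have := @ge0_integral_rV_addr R n v (h^\-)%E (measurable_funeneg mh) (funeneg_ge0 h).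
by move=> <-; apply: eq_integral => x _; rewrite ?funeposE ?funenegE.
Qed.

(** Also for integrals of the form oo - oo, whose value is -oo: the integral of G along a
segment is known to be finite for almost every segment only. *)
Lemma integral_ge0Zl d (T : measurableType d) (m : {measure set T -> \bar R})
    (k : R) (f : T -> \bar R) : 0 <= k -> measurable_fun setT f ->
  (\int[m]_t (k%:E * f t) = k%:E * \int[m]_t f t)%E.
Proof.
rewrite le_eqVlt => /predU1P[<-|k0] mf.
  by rewrite mul0e integral0_eq// => t _; rewrite mul0e.
rewrite integralE [in RHS]integralE.
have -> : (\int[m]_t (fun t => k%:E * f t)^\+ t = k%:E * \int[m]_t f^\+ t)%E.
  rewrite -ge0_integralZl//; [|exact: measurable_funepos|by rewrite lee_fin ltW].
  by apply: eq_integral => t _; rewrite (ge0_funeposM _ (ltW k0)).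
have -> : (\int[m]_t (fun t => k%:E * f t)^\- t = k%:E * \int[m]_t f^\- t)%E.
  rewrite -ge0_integralZl//; [|exact: measurable_funeneg|by rewrite lee_fin ltW].
  by apply: eq_integral => t _; rewrite (ge0_funenegM _ (ltW k0)).
have : (0 <= \int[m]_t f^\+ t)%E by exact: integral_ge0.
have : (0 <= \int[m]_t f^\- t)%E by exact: integral_ge0.
move: (\int[m]_t f^\- t)%E (\int[m]_t f^\+ t)%E => [b| |] [a| |]// _ _.
- by rewrite -EFinB -!EFinM mulrBr.
- by rewrite !gt0_muley.
- by rewrite !gt0_muley// gt0_muleNy.
- by rewrite !gt0_muley// gt0_muleNy.
Qed.

Lemma measurable_shift_line v : measurable_fun setT
  (fun z : 'rV[R]_n * measurableTypeR R => z.1 + z.2 *: v).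
Proof.
apply: measurable_fun_rVP => i; under eq_fun do rewrite !mxE.
apply: measurable_funD; first exact: (measurableT_comp (measurable_coord_rV i)).
by apply: measurable_funM => //; exact: measurable_snd.
Qed.

End bounds.

Section line_integrals.
Context {R : realType} {n : nat}.
Implicit Types (x v w : 'rV[R]_n) (f phi : 'rV[R]_n -> R) (r t B : R).
Local Notation mu := (@lebesgue_rV R n).
Local Notation leb := (@lebesgue_measure R).

Definition cube r : set 'rV[R]_n := open_box (fun=> - r) (fun=> r).

(** Local integrability, with cubes instead of compact sets because they are simpler to
translate. *)
Definition cube_integrable f := measurable_fun setT f /\
  forall r, (\int[mu]_(x in cube r) `|f x|%:E < +oo)%E.

(** A weight for integrals over [0, 1], so that Fubini and translations are applied on
the whole line. *)
Definition unit_itv t : R := \1_(`[0, 1]%classic : set R) t.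

Lemma unit_itvE t : unit_itv t = (0 <= t <= 1)%R%:R.
Proof.
rewrite /unit_itv indicE; congr (nat_of_bool _)%:R.
by apply/idP/idP; rewrite inE/= in_itv/=.
Qed.

Lemma measurable_unit_itv : measurable_fun setT (unit_itv : measurableTypeR R -> R).
Proof. exact: measurable_indic. Qed.

Lemma unit_itv_ge0 t : 0 <= unit_itv t.
Proof. by rewrite unit_itvE. Qed.

Lemma integral_unit_itv (F : R -> \bar R) :
  (\int[leb]_t (F t * (unit_itv t)%:E) = \int[leb]_(t in `[0%R, 1%R]) F t)%E.
Proof.
rewrite [RHS]integral_mkcond; apply: eq_integral => t _.
rewrite patchE /unit_itv indicE.
have -> : (t \in (`[0, 1]%classic : set R)) = (t \in `[0%R, 1%R]%classic) by [].
by case: ifP => _; rewrite ?mule1 ?mule0.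
Qed.

Lemma lebesgue_unit_itv : leb `[0%R, 1%R]%classic = 1%E.
Proof.
have := @lebesgue_measure_itv R `[0%R, 1%R].
by rewrite /= lte_fin ltr01 -EFinB subr0.
Qed.

(** The translates of phi by t w with t in [0, 1] are all supported in one larger cube,
so the bound is uniform in t. *)
Lemma integral_shift_bound f phi w B r t : cube_integrable f ->
  measurable_fun setT phi ->
  (forall x, `|phi x| <= B) -> (forall x, phi x != 0 -> cube r x) -> 0 <= t <= 1 ->
  (\int[mu]_x `|f x * phi (x - t *: w)|%:E <=
   B%:E * \int[mu]_(x in cube (r + eucl_norm w)) `|f x|%:E)%E.
Proof.
move=> [mf iF] mphi pB pr /andP[t0 t1].
have B0 : 0 <= B by exact: le_trans (pB 0).
have mK : measurable (cube (r + eucl_norm w)) by exact: measurable_cube.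
have mnf : measurable_fun setT (fun x => `|f x|%:E).
  by apply/measurable_EFinP; exact: measurableT_comp.
rewrite -ge0_integralZl//; last exact: measurable_funTS.
rewrite [leRHS]integral_mkcond; apply: ge0_le_integral => //.
- apply/measurable_EFinP; apply: measurableT_comp => //; apply: measurable_funM => //.
  exact: measurable_shift.
- apply/(measurable_restrictT _ _).1 => //; apply: measurable_funTS.
  exact: emeasurable_funM.
move=> x _; rewrite patchE.
have [phi0|/pr xr] := eqVneq (phi (x - t *: w)) 0.
  rewrite phi0 mulr0 normr0; case: ifP => // _.
  by rewrite mule_ge0// lee_fin.
rewrite ifT; last first.
  rewrite inE => j; have := xr j; rewrite /= !in_itv/= !mxE -!ltr_norml => xj.
  rewrite -[x ord0 j](subrK (t * w ord0 j)) (le_lt_trans (ler_normD _ _))//.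
  rewrite ltr_leD// normrM (ger0_norm t0) (le_trans _ (eucl_norm_coord w j))//.
  by rewrite ler_piMl.
by rewrite -EFinM lee_fin normrM mulrC ler_wpM2r.
Qed.

Lemma integral_shift_swap f phi w t : measurable_fun setT f -> measurable_fun setT phi ->
  (\int[mu]_x `|f (x + t *: w)%R * phi x|%:E = \int[mu]_x `|f x * phi (x - t *: w)|%:E)%E.
Proof.
move=> mf mphi; rewrite -[RHS](ge0_integral_rV_addr (t *: w)).
- by apply: eq_integral => x _; rewrite addrK.
- apply/measurable_EFinP; apply: measurableT_comp => //; apply: measurable_funM => //.
  exact: measurable_shift.
- by move=> x; rewrite lee_fin.
Qed.

Lemma measurable_line f w : measurable_fun setT f ->
  measurable_fun setT (fun z : 'rV[R]_n * measurableTypeR R => f (z.1 + z.2 *: w)).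
Proof. by move=> mf; apply: (measurableT_comp mf); exact: measurable_shift_line. Qed.

Lemma measurable_lineN f w : measurable_fun setT f ->
  measurable_fun setT (fun z : 'rV[R]_n * measurableTypeR R => f (z.1 - z.2 *: w)).
Proof.
move=> mf; under eq_fun do rewrite -scalerN.
exact: measurable_line.
Qed.

Lemma measurable_line_fiber f w x : measurable_fun setT f ->
  measurable_fun setT (fun t : R => f (x + t *: w)).
Proof.
move=> mf; apply: (measurableT_comp mf).
apply: measurable_fun_rVP => i; under eq_fun do rewrite !mxE.
by apply: measurable_funD => //; apply: measurable_funM.
Qed.

Lemma measurable_line_powR (p : R) f w : measurable_fun setT f ->
  measurable_fun setT (fun z : 'rV[R]_n * measurableTypeR R =>
    ((`|f (z.1 + z.2 *: w)%R| `^ p)%:E * (unit_itv z.2)%:E)%E).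
Proof.
move=> mf; apply: emeasurable_funM; apply/measurable_EFinP; last first.
  exact: (measurableT_comp measurable_unit_itv).
apply: (measurableT_comp (measurable_powR _)); apply: measurableT_comp => //.
exact: measurable_line.
Qed.

Lemma integrable_lineN f phi w B r : cube_integrable f -> measurable_fun setT phi ->
  (forall x, `|phi x| <= B) -> (forall x, phi x != 0 -> cube r x) ->
  (mu \x leb)%E.-integrable setT
    (fun z => (f z.1 * phi (z.1 - z.2 *: w) * unit_itv z.2)%:E).
Proof.
move=> iF mphi pB pr; have [mf iF'] := iF.
apply/integrable21ltyP.
  apply/measurable_EFinP; apply: measurable_funM.
    apply: measurable_funM; first exact: (measurableT_comp mf).
    exact: measurable_lineN.
  exact: (measurableT_comp measurable_unit_itv).
set A := (B%:E * \int[mu]_(x in cube (r + eucl_norm w)) `|f x|%:E)%E.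
have B0 : 0 <= B by exact: le_trans (pB 0).
have A0 : (0 <= A)%E by apply: mule_ge0; [rewrite lee_fin|exact: integral_ge0].
apply: (@le_lt_trans _ _ (\int[leb]_(t in `[0%R, 1%R]) cst A t)%E); last first.
  rewrite integral_cst// [X in (_ * X)%E](_ : _ = 1%E) ?mule1//; last exact: lebesgue_unit_itv.
  by rewrite /A lte_mul_pinfty.
rewrite -integral_unit_itv; apply: ge0_le_integral => //.
- by move=> t _; exact: integral_ge0.
- apply: (measurable_fun_fubini_tonelli_G (abse \o
    (fun z : 'rV[R]_n * measurableTypeR R => (f z.1 * phi (z.1 - z.2 *: w) * unit_itv z.2)%:E))) => //.
  apply: measurableT_comp => //.
  apply/measurable_EFinP; apply: measurable_funM.
    apply: measurable_funM; first exact: (measurableT_comp mf).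
    exact: measurable_lineN.
  exact: (measurableT_comp measurable_unit_itv).
- by move=> z; exact: abse_ge0.
- by apply: emeasurable_funM => //; apply/measurable_EFinP; exact: measurable_unit_itv.
move=> t _ /=; rewrite unit_itvE; have [t01|t01] := boolP (0 <= t <= 1); rewrite /=; last first.
  by rewrite mule0 integral0_eq// => x _; rewrite mulr0 normr0.
rewrite mule1; under eq_integral do rewrite mulr1.
exact: integral_shift_bound.
Qed.

(** For fixed t, the translation by t w reduces this to [integrable_lineN]. *)
Lemma integrable_line f phi w B r : cube_integrable f -> measurable_fun setT phi ->
  (forall x, `|phi x| <= B) -> (forall x, phi x != 0 -> cube r x) ->
  (mu \x leb)%E.-integrable setT
    (fun z => (f (z.1 + z.2 *: w) * phi z.1 * unit_itv z.2)%:E).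
Proof.
move=> iF mphi pB pr; have [mf iF'] := iF.
apply/integrable21ltyP.
  apply/measurable_EFinP; apply: measurable_funM.
    apply: measurable_funM; first exact: measurable_line.
    exact: (measurableT_comp mphi).
  exact: (measurableT_comp measurable_unit_itv).
have IF := integrable_lineN w iF mphi pB pr.
have /(integrable21ltyP _ _ (measurable_int _ IF)) HF := IF.
apply: le_lt_trans HF; rewrite le_eqVlt; apply/orP; left; apply/eqP.
apply: eq_integral => t _.
have E (h : 'rV[R]_n -> R) : measurable_fun setT h ->
    (\int[mu]_x `|(h x * unit_itv t)%:E| = (unit_itv t)%:E * \int[mu]_x `|h x|%:E)%E.
  move=> mh; rewrite -ge0_integralZl//.
  - apply: eq_integral => x _.
    by rewrite abse_EFin normrM EFinM muleC (ger0_norm (unit_itv_ge0 t)).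
  - by apply/measurable_EFinP; exact: measurableT_comp.
  - by rewrite lee_fin unit_itv_ge0.
rewrite (E (fun x => f (x + t *: w) * phi x)); last first.
  by apply: measurable_funM => //; exact: (measurable_shift (t *: w) mf).
rewrite (E (fun x => f x * phi (x - t *: w))) ?integral_shift_swap//.
by apply: measurable_funM => //; exact: (measurable_shift (- (t *: w)) mphi).
Qed.

End line_integrals.

(** * The segment identity tested on bumps *)

Section along_lines.
Context {R : realType} {n : nat}.
Implicit Types (x v w : 'rV[R]_n) (f phi u : 'rV[R]_n -> R) (r t B c : R).
Local Notation mu := (@lebesgue_rV R n).
Local Notation leb := (@lebesgue_measure R).

(** A point outside the larger open cube has a neighbourhood on which phi vanishes. *)
Lemma derive_support phi v r : (forall x, phi x != 0 -> cube r x) ->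
  forall x, 'D_v phi x != 0 -> cube (r + 1) x.
Proof.
move=> pr x; apply: contraNP => /existsNP[j xj].
have {}xj : r < `|x ord0 j|.
  rewrite ltNge; apply/negP => xr; apply: xj.
  by rewrite /= in_itv/= -ltr_norml (le_lt_trans xr)// ltrDl.
rewrite (@near_eq_derive _ _ _ _ (cst 0)) ?derive_cst//.
have cx : (fun y : 'rV[R]_n => `|y ord0 j|) @ x --> `|x ord0 j|.
  apply: (@continuous_comp _ _ _ (fun y : 'rV[R]_n => y ord0 j : R) normr x).
    exact: coord_continuous.
  exact: norm_continuous.
near=> y; apply/eqP; apply: contraPT (xj) => /pr/(_ j); rewrite /= in_itv/= -ltr_norml => yr.
have : r < `|y ord0 j| by near: y; exact: (cvgr_gt _ cx).
by rewrite ltNge (ltW yr).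
Unshelve. all: by end_near. Qed.

Lemma derive_shift phi v w x : 'D_v (fun y => phi (y - w)) x = 'D_v phi (x - w).
Proof.
rewrite /derive (_ : (fun h : R => _) = fun h : R =>
  h^-1 *: ((phi \o shift (x - w)) (h *: v) - phi (x - w)))//.
by apply/funext => h /=; rewrite addrA.
Qed.

Lemma continuous_line x v : continuous (fun t : R => x - t *: v).
Proof.
move=> t; apply: cvgB; first exact: cvg_cst.
by apply: cvgZ; [exact: cvg_id|exact: cvg_cst].
Qed.

Lemma is_derive_line phi x v t : flat_alg phi ->
  is_derive t 1 (fun s : R => - phi (x - s *: v)) ('D_v phi (x - t *: v)).
Proof.
move=> F; have dphi := differentiable_flat_alg (x - t *: v) F.
have E : (fun h : R => h^-1 *: (((fun s : R => phi (x - s *: v)) \o shift t) (h *: 1)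
      - phi (x - t *: v))) =
    (fun h : R => h^-1 *: ((phi \o shift (x - t *: v)) (h *: - v) - phi (x - t *: v))).
  apply/funext => h /=; congr (_ *: (phi _ - _)).
  by rewrite [h *: 1]mulr1 scalerDl scalerN opprD addrC -addrA (addrC (- _) x).
have D : is_derive t 1 (fun s : R => phi (x - s *: v)) ('D_(- v) phi (x - t *: v)).
  apply: DeriveDef; rewrite /derivable /derive E//.
  exact: diff_derivable.
have -> : 'D_v phi (x - t *: v) = - 'D_(- v) phi (x - t *: v).
  by rewrite !deriveE// linearN opprK.
exact: is_deriveN.
Qed.

Lemma integral_derive_line phi x v : flat_alg phi ->
  (\int[leb]_(t in `[0%R, 1%R]) ('D_v phi (x - t *: v))%:E =
   (phi x - phi (x - v))%:E)%E.
Proof.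
move=> F; have F' := derive_flat_alg v F.
rewrite (@continuous_FTC2 _ _ (fun s : R => - phi (x - s *: v)) 0 1 ltr01).
- by rewrite scale1r scale0r subr0 -EFinB opprK addrC.
- apply: continuous_subspaceT => t.
  apply: (@continuous_comp _ _ _ (fun s : R => x - s *: v) ('D_v phi)).
    exact: continuous_line.
  exact: continuous_flat_alg.
- have cF : continuous (fun s : R => - phi (x - s *: v)).
    move=> t; apply: cvgN.
    apply: (@continuous_comp _ _ _ (fun s : R => x - s *: v) phi).
      exact: continuous_line.
    exact: continuous_flat_alg.
  split.
  + by move=> t _; exact: (@ex_derive _ _ _ _ _ _ _ (is_derive_line x v t F)).
  + by apply: cvg_at_right_filter; exact: cF.
  + by apply: cvg_at_left_filter; exact: cF.
- move=> t _; rewrite derive1E.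
  exact: (@derive_val _ _ _ _ _ _ _ (is_derive_line x v t F)).
Qed.

Lemma integrable_mul_shift f phi w B r t : cube_integrable f ->
  measurable_fun setT phi ->
  (forall x, `|phi x| <= B) -> (forall x, phi x != 0 -> cube r x) -> 0 <= t <= 1 ->
  mu.-integrable setT (fun x => (f x * phi (x - t *: w))%:E).
Proof.
move=> iF mphi pB pr t01; have [mf iF'] := iF; apply/integrableP; split.
  apply/measurable_EFinP; apply: measurable_funM => //.
  exact: (measurable_shift (- (t *: w)) mphi).
apply: (le_lt_trans (integral_shift_bound w iF mphi pB pr t01)).
by rewrite lte_mul_pinfty// lee_fin (le_trans _ (pB 0)).
Qed.

Lemma integrable_mul f phi B r : cube_integrable f -> measurable_fun setT phi ->
  (forall x, `|phi x| <= B) -> (forall x, phi x != 0 -> cube r x) ->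
  mu.-integrable setT (fun x => (f x * phi x)%:E).
Proof.
move=> iF mphi pB pr; have t01 : 0 <= (0 : R) <= 1 by rewrite lexx ler01.
apply: eq_integrable (integrable_mul_shift 0 iF mphi pB pr t01) => // x _.
by rewrite scale0r subr0.
Qed.

Lemma cube_integrableN f : cube_integrable f -> cube_integrable (fun x => - f x).
Proof.
move=> [mf iF]; split; first exact: measurableT_comp.
by move=> r; under eq_integral do rewrite normrN.
Qed.

Lemma integrable_rV_addr (h : 'rV[R]_n -> \bar R) v :
  mu.-integrable setT h -> mu.-integrable setT (fun x => h (x + v)).
Proof.
move=> /integrableP[mh hoo]; apply/integrableP; split; first exact: measurable_shift.
have mah : measurable_fun setT (abse \o h) by exact: measurableT_comp.
by have /= -> := ge0_integral_rV_addr v mah (fun x => abse_ge0 (h x)).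
Qed.

Lemma flat_alg_shift phi v : flat_alg phi -> flat_alg (fun x => phi (x - v)).
Proof.
elim => {phi} [P c a i|c|f g _ Ff _ Fg|f g _ Ff _ Fg].
- rewrite (_ : (fun _ => _) =
      fun x => flat_exp P (c * x ord0 i + (a - c * v ord0 i))); first by constructor.
  by apply/funext => x; rewrite !mxE; congr (flat_exp _ _); ring.
- exact: flat_alg_cst.
- exact: flat_algD.
- exact: flat_algM.
Qed.

Lemma shift_support phi v r : (forall x, phi x != 0 -> cube r x) ->
  forall x, phi (x - v) != 0 -> cube (r + eucl_norm v) x.
Proof.
move=> pr x /pr xr j; have := xr j; rewrite /= !in_itv/= !mxE -!ltr_norml => xj.
rewrite -[x ord0 j](subrK (v ord0 j)) (le_lt_trans (ler_normD _ _))//.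
by rewrite ltr_leD// eucl_norm_coord.
Qed.

Lemma cube_indic_bound r x : `|\1_(cube r) x : R| <= 1.
Proof. by rewrite indicE; case: (_ \in _); rewrite ?normr0 ?normr1. Qed.

Lemma cube_indic_support r x : (\1_(cube r) x : R) != 0 -> cube r x.
Proof. by rewrite indicE; case: (boolP (x \in cube r)) => [/set_mem//|_]; rewrite eqxx. Qed.

Lemma measurable_cube_indic r : measurable_fun setT (\1_(cube r) : 'rV[R]_n -> R).
Proof. by apply: measurable_indic; exact: measurable_cube. Qed.

Lemma integral_cube_indic r (f : 'rV[R]_n -> R) :
  (\int[mu]_x (f x * \1_(cube r) x)%:E = \int[mu]_(x in cube r) (f x)%:E)%E.
Proof.
rewrite [RHS]integral_mkcond; apply: eq_integral => x _; rewrite patchE indicE.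
by case: ifP => _; rewrite ?mulr1 ?mulr0.
Qed.

Lemma cube_integrable_shift f w : cube_integrable f -> cube_integrable (fun x => f (x + w)).
Proof.
move=> iF; have [mf iF'] := iF; split; first exact: measurable_shift.
move=> r; rewrite -integral_cube_indic.
have t01 : 0 <= (1 : R) <= 1 by rewrite ler01 lexx.
have := integral_shift_bound w iF (measurable_cube_indic r) (cube_indic_bound r)
  (@cube_indic_support r) t01.
rewrite -integral_shift_swap//; last exact: measurable_cube_indic.
rewrite mul1e => H; apply: le_lt_trans (iF' _); apply: le_trans H.
rewrite le_eqVlt; apply/orP; left; apply/eqP; apply: eq_integral => x _.
have i0 : 0 <= \1_(cube r) x :> R by rewrite indicE.
by rewrite scale1r normrM (ger0_norm i0).
Qed.

Lemma cube_integrableP f r : cube_integrable f -> mu.-integrable (cube r) (EFin \o f).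
Proof.
move=> [mf iF]; apply/integrableP; split; last exact: iF.
by apply: measurable_funTS; exact/measurable_EFinP.
Qed.

Section identity.
Variables (u G : 'rV[R]_n -> R) (w : 'rV[R]_n).
Hypotheses (iu : cube_integrable u) (iG : cube_integrable G).
Hypothesis weak : forall phi r, flat_alg phi -> (forall x, phi x != 0 -> cube r x) ->
  (\int[mu]_x (u x * 'D_w phi x)%:E = - \int[mu]_x (G x * phi x)%:E)%E.

Let F x := (\int[leb]_t (G (x + t *: w)%R * unit_itv t)%:E)%E.

(** The positive and negative parts are treated separately, because G need not be
integrable on every segment. *)
Lemma measurable_line_integral : measurable_fun setT F.
Proof.
have mG := iG.1.
pose H (z : 'rV[R]_n * measurableTypeR R) := (G (z.1 + z.2 *: w) * unit_itv z.2)%:E.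
have mH : measurable_fun setT H.
  apply/measurable_EFinP; apply: measurable_funM; first exact: measurable_line.
  exact: (measurableT_comp measurable_unit_itv).
rewrite (_ : F = fun x => \int[leb]_t (H^\+ (x, t)) - \int[leb]_t (H^\- (x, t)))%E.
  apply: emeasurable_funB.
    by apply: measurable_fun_fubini_tonelli_F => //; exact: measurable_funepos.
  by apply: measurable_fun_fubini_tonelli_F => //; exact: measurable_funeneg.
apply/funext => x; rewrite /F integralE.
by congr (_ - _)%E; apply: eq_integral => t _; rewrite ?funeposE ?funenegE.
Qed.

Lemma integrable_line_integral r : mu.-integrable (cube r) F.
Proof.
have IL := integrable_line w iG (measurable_cube_indic r) (cube_indic_bound r)
  (@cube_indic_support r).
have := integrable_fubini_F IL.
rewrite /fubini_F => H; apply/(integrable_mkcond _ (measurable_cube r)).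
apply: eq_integrable H => // x _.
rewrite patchE /= indicE; case: ifPn => xr.
  by apply: eq_integral => t _; rewrite /= mulr1.
by rewrite [LHS]integral0_eq// => t _; rewrite /= mulr0 mul0r.
Qed.

(** A translation moves the increment onto phi: the left-hand side is the integral of
u(x) (phi(x - w) - phi(x)). By the fundamental theorem of calculus this increment of phi is
the integral over t in [0, 1] of - D_w phi(x - t w). After Fubini, the weak derivative is
applied for each t to the translate of phi by t w; a translation by t w and Fubini again
give the right-hand side. *)
Lemma shift_identity_bump phi r B : flat_alg phi -> (forall x, 0 <= phi x) ->
  (forall x, `|phi x| <= B) -> (forall x, phi x != 0 -> cube r x) ->
  (\int[mu]_x ((u (x + w)%R - u x)%:E * (phi x)%:E) = \int[mu]_x (F x * (phi x)%:E))%E.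
Proof.
move=> Fphi phi0 phiB phir.
have mphi := measurable_flat_alg Fphi.
have Fpsi := derive_flat_alg w Fphi.
have mpsi := measurable_flat_alg Fpsi.
have [C psiC] := flat_alg_bounded Fpsi.
have psir := derive_support phir (v := w).
have I0 := integrable_mul iu mphi phiB phir.
have I1 := integrable_mul_shift w iu mphi phiB phir (_ : 0 <= 1 <= 1).
have {}I1 : mu.-integrable setT (fun x => (u x * phi (x - w))%:E).
  have := I1; rewrite lexx ler01 => /(_ isT); apply: eq_integrable => // x _.
  by rewrite scale1r.
have I2 : mu.-integrable setT (fun x => (u (x + w) * phi x)%:E).
  apply: eq_integrable (integrable_rV_addr w I1) => // x _.
  by rewrite addrK.
have L : (\int[mu]_x ((u (x + w)%R - u x)%:E * (phi x)%:E) =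
    \int[mu]_x (u x * phi (x - w))%:E - \int[mu]_x (u x * phi x)%:E)%E.
  rewrite -(integral_rV_addr w (measurable_int _ I1)).
  under [X in (_ = X - _)%E]eq_integral do rewrite addrK.
  rewrite -integralB_EFin//; apply: eq_integral => x _.
  by rewrite -EFinM -EFinB mulrBl.
have L2 : (\int[mu]_x (u x * phi (x - w))%:E - \int[mu]_x (u x * phi x)%:E =
    \int[mu]_x \int[leb]_t (- u x * 'D_w phi (x - t *: w)%R * unit_itv t)%:E)%E.
  rewrite -integralB_EFin//; apply: eq_integral => x _.
  transitivity (\int[leb]_(t in `[0%R, 1%R])
      ((- u x)%:E * ('D_w phi (x - t *: w)%R)%:E))%E; last first.
    rewrite -integral_unit_itv; apply: eq_integral => t _.
    by rewrite -!EFinM.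
  rewrite integralZl//; last first.
    apply: continuous_compact_integrable; first exact: segment_compact.
    apply: continuous_subspaceT => t.
    apply: (@continuous_comp _ _ _ (fun s : R => x - s *: w) ('D_w phi)).
      exact: continuous_line.
    exact: continuous_flat_alg.
  by rewrite integral_derive_line// -EFinM -EFinB; congr EFin; ring.
have IL := integrable_lineN w (cube_integrableN iu) mpsi psiC psir.
have IG := integrable_line w iG mphi phiB phir.
rewrite L L2 (Fubini IL)/=.
have R1 : (\int[mu]_x (F x * (phi x)%:E) =
   \int[mu]_x \int[leb]_t (G (x + t *: w)%R * phi x * unit_itv t)%:E)%E.
  apply: eq_integral => x _; rewrite muleC /F -integral_ge0Zl//.
    by apply: eq_integral => t _; rewrite -EFinM mulrCA mulrA.
  apply/measurable_EFinP; apply: measurable_funM; last exact: measurable_unit_itv.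
  exact: (measurable_line_fiber w x iG.1).
rewrite R1 (Fubini IG)/=.
apply: eq_integral => t _.
have mpsit := measurable_shift (- (t *: w)) mpsi.
have mphit := measurable_shift (- (t *: w)) mphi.
have mGt := measurable_shift (t *: w) iG.1.
have -> : (\int[mu]_x (- u x * 'D_w phi (x - t *: w)%R * unit_itv t)%:E =
    (unit_itv t)%:E * \int[mu]_x (- u x * 'D_w phi (x - t *: w)%R)%:E)%E.
  rewrite -integral_ge0Zl ?unit_itv_ge0//.
    by apply: eq_integral => x _; rewrite -EFinM mulrC.
  by apply/measurable_EFinP; apply: measurable_funM => //; apply: measurableT_comp => //; exact: iu.1.
have -> : (\int[mu]_x (G (x + t *: w)%R * phi x * unit_itv t)%:E =
    (unit_itv t)%:E * \int[mu]_x (G (x + t *: w)%R * phi x)%:E)%E.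
  rewrite -integral_ge0Zl ?unit_itv_ge0//.
    by apply: eq_integral => x _; rewrite -EFinM mulrC.
  by apply/measurable_EFinP; apply: measurable_funM.
congr (_ * _)%E.
have Fphit := flat_alg_shift (t *: w) Fphi.
have phitr := @shift_support phi (t *: w) r phir.
have mDt := measurable_flat_alg (derive_flat_alg w Fphit).
have [D phitD] := flat_alg_bounded (derive_flat_alg w Fphit).
have It := integrable_mul iu mDt phitD (derive_support phitr (v := w)).
transitivity (\int[mu]_x ((-1)%:E * (u x * 'D_w (fun y => phi (y - t *: w)) x)%:E))%E.
  by apply: eq_integral => x _; rewrite derive_shift -EFinM; congr EFin; ring.
rewrite integralZl// (weak Fphit phitr) EFinN mulN1e oppeK -(integral_rV_addr (t *: w)).
  by apply: eq_integral => x _; rewrite addrK.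
by apply/measurable_EFinP; apply: measurable_funM => //; exact: iG.1.
Qed.

End identity.

End along_lines.

(** * The modulus along a direction of weak differentiability *)

Section line_modulus.
Context {R : realType} {n : nat}.
Implicit Types (x v w : 'rV[R]_n) (f g u G : 'rV[R]_n -> R) (r t B c : R).
Local Notation mu := (@lebesgue_rV R n).
Local Notation leb := (@lebesgue_measure R).

Lemma shift_identity u G w : cube_integrable u -> cube_integrable G ->
  (forall phi r, flat_alg phi -> (forall x, phi x != 0 -> cube r x) ->
    (\int[mu]_x (u x * 'D_w phi x)%:E = - \int[mu]_x (G x * phi x)%:E)%E) ->
  \forall x \ae mu, (u (x + w) - u x)%:E =
    (\int[leb]_t (G (x + t *: w)%R * unit_itv t)%:E)%E.
Proof.
move=> iu iG weak.
apply: ae_eq_bump.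
- by apply/measurable_EFinP; apply: measurable_diff; exact: iu.1.
- exact: measurable_line_integral.
- move=> r; have I1 := cube_integrableP r (cube_integrable_shift w iu).
  have I2 := cube_integrableP r iu.
  apply: eq_integrable (integrableB (measurable_cube r) I1 I2); first exact: measurable_cube.
  by move=> x _ /=; rewrite EFinB.
- by move=> r; exact: integrable_line_integral.
- move=> k a b; have [r abr] := sub_box_cube a b.
  have b1 (x : 'rV[R]_n) : `|box_bump k a b x| <= 1.
    by have /andP[b0 b1] := bump_itv k a b x; rewrite ger0_norm.
  apply: (shift_identity_bump iu iG weak (flat_alg_bump k a b) _ b1 (r := r)).
    by move=> x; have /andP[] := bump_itv k a b x.
  by move=> x /bump_neq0/abr.
Qed.

(** Hoelder's inequality against the constant 1, for the uniform probability. *)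
Lemma jensen_unit_itv (p : R) (h : R -> R) : 1 <= p -> measurable_fun setT h ->
  (forall t, 0 <= h t) ->
  ((\int[leb]_(t in `[0%R, 1%R]) (h t)%:E) `^ p <=
    \int[leb]_(t in `[0%R, 1%R]) (h t `^ p)%:E)%E.
Proof.
move=> p1 mh h0; have p0 : 0 < p by lra.
have mhp : measurable_fun setT (fun t => h t `^ p).
  exact: (measurableT_comp (measurable_powR _)).
pose P := uniform_prob (@ltr01 R).
have PE (f : R -> \bar R) : measurable_fun setT f -> (forall t, 0 <= f t)%E ->
    (\int[leb]_(t in `[0%R, 1%R]) f t = \int[P]_t f t)%E.
  by move=> mf f0; rewrite integral_uniform// subr0 invr1 mul1e.
have mhE : measurable_fun setT (fun t => (h t)%:E) by exact/measurable_EFinP.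
have mhpE : measurable_fun setT (fun t => (h t `^ p)%:E) by exact/measurable_EFinP.
have h0E t : (0 <= (h t)%:E)%E by rewrite lee_fin.
have hp0E t : (0 <= (h t `^ p)%:E)%E by rewrite lee_fin powR_ge0.
rewrite (PE _ mhE h0E) (PE _ mhpE hp0E).
have [->|pN1] := eqVneq p 1.
  rewrite poweRe1; last by apply: integral_ge0.
  by under [leRHS]eq_integral do rewrite powRr1//.
have p1' : 1 < p by rewrite lt_neqAle eq_sym pN1.
have := @hoelder _ _ R P h (cst 1) p (p / (p - 1)) mh (measurable_cst _) p0.
have q0 : 0 < p / (p - 1) by rewrite divr_gt0// subr_gt0.
have pq : p^-1 + (p / (p - 1))^-1 = 1.
  by rewrite invf_div; field; rewrite gt_eqF.
move=> /(_ q0 pq).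
rewrite Lnorm1.
have -> : ('N[P]_(p / (p - 1))%:E[EFin \o cst 1%R] = 1)%E.
  rewrite (_ : EFin \o _ = cst 1%E)// Lnorm_cst1.
  rewrite [X in (X `^ _)%E](_ : _ = 1%E); last exact: probability_setT.
  by rewrite poweR_EFin powR1.
rewrite mule1.
have -> : (\int[P]_t `|(EFin \o (h \* cst 1)%R) t| = \int[P]_t (h t)%:E)%E.
  by apply: eq_integral => t _; rewrite /= mulr1 ger0_norm.
move=> H; have I0 : (0 <= \int[P]_t (h t)%:E)%E by exact: integral_ge0.
have := le_poweR (ltW p0) I0 H; rewrite poweR_Lnorm; last by rewrite gt_eqF.
move=> /le_trans; apply.
rewrite le_eqVlt; apply/orP; left; apply/eqP; apply: eq_integral => t _.
by rewrite /= ger0_norm.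
Qed.

Let F G w x := (\int[leb]_t (G (x + t *: w)%R * unit_itv t)%:E)%E.

Lemma line_integral_le G w x : measurable_fun setT G ->
  (`|F G w x| <= \int[leb]_(t in `[0%R, 1%R]) `|G (x + t *: w)%R|%:E)%E.
Proof.
move=> mG.
have mGx : measurable_fun setT (fun t : measurableTypeR R => G (x + t *: w)).
  exact: measurable_line_fiber.
have mH : measurable_fun setT (fun t : measurableTypeR R => (G (x + t *: w) * unit_itv t)%:E).
  by apply/measurable_EFinP; apply: measurable_funM => //; exact: measurable_unit_itv.
apply: (le_trans (le_abse_integral _ measurableT mH)).
rewrite -integral_unit_itv le_eqVlt; apply/orP; left; apply/eqP.
apply: eq_integral => t _.
by rewrite abse_EFin normrM EFinM (ger0_norm (unit_itv_ge0 t)).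
Qed.

(** For each t the translate of G has the same integral as G. *)
Lemma integral_line_powR (p : R) G w : measurable_fun setT G ->
  (\int[mu]_x \int[leb]_(t in `[0%R, 1%R]) (`|G (x + t *: w)%R| `^ p)%:E =
   \int[mu]_x (`|G x| `^ p)%:E)%E.
Proof.
move=> mG.
pose H (z : 'rV[R]_n * measurableTypeR R) :=
  ((`|G (z.1 + z.2 *: w)%R| `^ p)%:E * (unit_itv z.2)%:E)%E.
have H0 z : (0 <= H z)%E by rewrite mule_ge0// lee_fin ?powR_ge0 ?unit_itv_ge0.
have mH : measurable_fun setT H by exact: measurable_line_powR.
transitivity (\int[mu]_x \int[leb]_t H (x, t))%E.
  by apply: eq_integral => x _; rewrite -integral_unit_itv.
have mGp : measurable_fun setT (fun x => (`|G x| `^ p)%:E).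
  apply/measurable_EFinP; apply: (measurableT_comp (measurable_powR _)).
  exact: measurableT_comp.
have Gp0 x : (0 <= (`|G x| `^ p)%:E)%E by rewrite lee_fin powR_ge0.
rewrite (fubini_tonelli H mH H0).
transitivity (\int[leb]_t ((\int[mu]_x (`|G x| `^ p)%:E) * (unit_itv t)%:E))%E.
  apply: eq_integral => t _; rewrite /H/=.
  have It0 : (0 <= (unit_itv t)%:E)%E by rewrite lee_fin unit_itv_ge0.
  rewrite (ge0_integralZr mu measurableT (measurable_shift (t *: w) mGp) _ It0); last first.
    by move=> x _; exact: Gp0.
  by rewrite (ge0_integral_rV_addr (t *: w) mGp Gp0).
rewrite integral_unit_itv integral_cst//.
by rewrite [X in (_ * X)%E](_ : _ = 1%E) ?mule1//; exact: lebesgue_unit_itv.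
Qed.

Lemma modulus_line_fin (p : R) u G w : 1 <= p -> measurable_fun setT u ->
  measurable_fun setT G ->
  (\forall x \ae mu, (u (x + w) - u x)%:E = F G w x) ->
  (modulus p%:E u w <= 'N[mu]_p%:E[EFin \o G])%E.
Proof.
move=> p1 mu_ mG uG; have p0 : 0 < p by lra.
rewrite /modulus unlock.
apply: le_poweR; first by rewrite invr_ge0 ltW.
  by apply: integral_ge0 => x _; exact: poweR_ge0.
have mI : measurable_fun setT (fun x =>
    \int[leb]_(t in `[0%R, 1%R]) (`|G (x + t *: w)%R| `^ p)%:E)%E.
  pose H (z : 'rV[R]_n * measurableTypeR R) :=
    ((`|G (z.1 + z.2 *: w)%R| `^ p)%:E * (unit_itv z.2)%:E)%E.
  rewrite (_ : (fun x => _) = fun x => \int[leb]_t H (x, t))%E.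
    apply: measurable_fun_fubini_tonelli_F; first exact: measurable_line_powR.
    by move=> z; rewrite mule_ge0// lee_fin ?powR_ge0 ?unit_itv_ge0.
  by apply/funext => x; rewrite -integral_unit_itv.
apply: (@le_trans _ _ (\int[mu]_x \int[leb]_(t in `[0%R, 1%R]) (`|G (x + t *: w)%R| `^ p)%:E)%E).
  apply: ae_ge0_le_integral => //.
  - by move=> x _; exact: poweR_ge0.
  - apply: (measurableT_comp (measurable_poweR p)); apply: measurableT_comp => //.
    by apply/measurable_EFinP; exact: measurable_diff.
  - by move=> x _; apply: integral_ge0 => t _; rewrite lee_fin powR_ge0.
  - apply: filterS uG => x E _; rewrite E.
    apply: (le_trans (le_poweR (ltW p0) (abse_ge0 _) (line_integral_le w x mG))).
    apply: (@jensen_unit_itv p (fun t => `|G (x + t *: w)|)) => //.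
    by apply: measurableT_comp => //; exact: measurable_line_fiber.
by rewrite integral_line_powR.
Qed.

(** The bound on |G| fails on a null set, which a given segment may meet badly. By Tonelli,
for almost every x it holds at almost every point of the segment from x to x + w. *)
Lemma modulus_line_oo u G w : measurable_fun setT u -> measurable_fun setT G ->
  (\forall x \ae mu, (u (x + w) - u x)%:E = F G w x) ->
  (modulus +oo%E u w <= 'N[mu]_+oo%E[EFin \o G])%E.
Proof.
move=> mu_ mG uG; rewrite /modulus unlock lebesgue_rVT_gt0.
set M := ess_sup mu (abse \o (EFin \o G)).
have GM : \forall x \ae mu, (`|G x|%:E <= M)%E by exact: ess_sup_ge.
have mnG : measurable_fun setT (fun x => `|G x|%:E).
  by apply/measurable_EFinP; exact: measurableT_comp.
pose h (z : 'rV[R]_n * measurableTypeR R) : \bar R :=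
  if (`|G (z.1 + z.2 *: w)%R|%:E <= M)%E then 0%E else 1%E.
have mh : measurable_fun setT h.
  apply: measurable_fun_ifT => //; apply: measurable_fun_lee => //.
  exact: (measurableT_comp mnG (measurable_shift_line w)).
have h0 z : (0 <= h z)%E by rewrite /h; case: ifP.
have hae : \forall z \ae (mu \x leb)%E, h z = 0%E.
  suff /(ae_eq_integral_abs _ measurableT mh).1 : (\int[mu \x leb]_z `|h z| = 0)%E.
    by apply: filterS => z; exact.
  under eq_integral do rewrite gee0_abs//.
  rewrite fubini_tonelli2//; apply: integral0_eq => t _.
  have mht : measurable_fun setT (fun x => h (x, t)).
    apply: measurable_fun_ifT => //; apply: measurable_fun_lee => //.
    exact: (measurable_shift (t *: w) mnG).
  rewrite /fubini_G -[RHS](_ : \int[mu]_x `|h (x, t)| = 0)%E; last first.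
    apply/(ae_eq_integral_abs _ measurableT mht).2.
    by apply: filterS (ae_shift (t *: w) GM) => x Gx _; rewrite /h/= Gx.
  by apply: eq_integral => x _; rewrite gee0_abs.
apply/ess_supP; apply: filterS2 uG (ae_product hae) => x E Hx.
rewrite (_ : (abse \o _) x = `|F G w x|)%E; last by rewrite -E.
apply: (le_trans (line_integral_le w x mG)).
apply: (@le_trans _ _ (\int[leb]_(t in `[0%R, 1%R]) cst M t)%E).
  apply: ae_ge0_le_integral => //.
  - apply: measurable_funTS; apply/measurable_EFinP; apply: measurableT_comp => //.
    exact: measurable_line_fiber.
  - move=> t _ /=; apply: ess_sup_gee; first exact: lebesgue_rVT_gt0.
    by apply: nearW => z; exact: abse_ge0.
  - apply: filterS Hx => t + _; rewrite /h/=; case: ifPn => // _ /eqP.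
    by rewrite onee_eq0.
rewrite integral_cst//.
by rewrite [X in (_ * X)%E](_ : _ = 1%E) ?mule1//; exact: lebesgue_unit_itv.
Qed.

End line_modulus.

(** * First order smoothness and the estimate *)

Section gradient.
Context {R : realType} {n : nat}.
Implicit Types (x y v w : 'rV[R]_n) (f u G : 'rV[R]_n -> R) (r t B c : R).
Local Notation mu := (@lebesgue_rV R n).

Lemma Lnorm_le_scale (p : \bar R) c (f g : 'rV[R]_n -> R) : (1 <= p)%E -> 0 <= c ->
  measurable_fun setT f -> measurable_fun setT g ->
  (forall x, `|f x| <= c * `|g x|) ->
  ('N[mu]_p[EFin \o f] <= c%:E * 'N[mu]_p[EFin \o g])%E.
Proof.
move=> p1 c0 mf mg fg; case: p p1 => [p p1|_|//]; last first.
  rewrite unlock lebesgue_rVT_gt0; apply/ess_supP.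
  have := ess_sup_ge mu (abse \o (EFin \o g)); apply: filterS => x gx /=.
  apply: (@le_trans _ _ (c%:E * `|g x|%:E)%E); first by rewrite -EFinM lee_fin.
  by rewrite lee_wpmul2l.
rewrite lee_fin in p1; have p0 : 0 < p by lra.
have pV0 : 0 <= p^-1 by rewrite invr_ge0 ltW.
have mgp : measurable_fun setT (fun x => (`|(g x)%:E| `^ p)%E).
  apply: (measurableT_comp (measurable_poweR p)); apply: measurableT_comp => //.
  exact/measurable_EFinP.
have mfp : measurable_fun setT (fun x => (`|(f x)%:E| `^ p)%E).
  apply: (measurableT_comp (measurable_poweR p)); apply: measurableT_comp => //.
  exact/measurable_EFinP.
have cp0 : (0 <= (c `^ p)%:E)%E by rewrite lee_fin powR_ge0.
have gp0 x : setT x -> (0 <= `|(g x)%:E| `^ p)%E by move=> _; exact: poweR_ge0.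
have H : (\int[mu]_x (`|(f x)%:E| `^ p) <= (c `^ p)%:E * \int[mu]_x (`|(g x)%:E| `^ p))%E.
  rewrite -(ge0_integralZl mu measurableT mgp gp0 cp0).
  apply: ge0_le_integral => //.
  - by move=> x _; exact: poweR_ge0.
  - exact: emeasurable_funM.
  - move=> x _; rewrite !poweR_EFin -EFinM lee_fin -powRM//.
    by rewrite ge0_ler_powR ?nnegrE ?mulr_ge0// ltW.
rewrite unlock.
have I0 : (0 <= \int[mu]_x (`|(g x)%:E| `^ p))%E by exact: integral_ge0.
have If0 : (0 <= \int[mu]_x (`|(f x)%:E| `^ p))%E.
  by apply: integral_ge0 => x _; exact: poweR_ge0.
apply: (le_trans (le_poweR pV0 If0 H)).
rewrite (poweRM _ cp0 I0) poweR_EFin -powRrM divff ?powRr1//.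
by rewrite gt_eqF.
Qed.

Lemma cube_integrable_Lfun (p : \bar R) u : (1 <= p)%E -> u \in Lfun mu p ->
  cube_integrable u.
Proof.
move=> p1 /andP[]; rewrite !inE/= => mu_ uoo; split => // r.
have mnu : measurable_fun setT (fun x => `|u x|%:E).
  by apply/measurable_EFinP; exact: measurableT_comp.
have mK : measurable (cube r : set 'rV[R]_n) by exact: measurable_cube.
have cubeoo : (mu (cube r) < +oo)%E by exact: lebesgue_rV_open_box_fin.
move: uoo; rewrite /finite_norm; case: p p1 => [p p1|_|//] uoo; last first.
  have [M HM] : exists M, \forall x \ae mu, `|u x| <= M.
    by apply: ess_supr_bounded; move: uoo; rewrite unlock lebesgue_rVT_gt0.
  apply: (@le_lt_trans _ _ (\int[mu]_(x in cube r) cst `|M|%:E x)%E).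
    apply: ae_ge0_le_integral => //.
    - exact: measurable_funTS.
    - by move=> x _; rewrite lee_fin.
    apply: filterS HM => x HM _ /=; rewrite lee_fin (le_trans HM)//.
    exact: ler_norm.
  by rewrite integral_cst//= lte_mul_pinfty.
rewrite lee_fin in p1; have p0 : 0 < p by lra.
have mup : measurable_fun setT (fun x => (`|u x| `^ p)%:E).
  apply/measurable_EFinP; apply: (measurableT_comp (measurable_powR _)).
  exact: measurableT_comp.
have Ioo : (\int[mu]_x (`|u x| `^ p)%:E < +oo)%E.
  have := poweR_lty p uoo; rewrite poweR_Lnorm; last by rewrite gt_eqF.
  by [].
apply: (@le_lt_trans _ _ (\int[mu]_(x in cube r) (1 + (`|u x| `^ p)%:E))%E).
  apply: ge0_le_integral => //.
  - exact: measurable_funTS.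
  - by apply: emeasurable_funD => //; exact: measurable_funTS.
  - move=> x _; rewrite -EFinD lee_fin.
    have [u1|u1] := leP `|u x| 1; first by rewrite (le_trans u1)// lerDl powR_ge0.
    rewrite (@le_trans _ _ (`|u x| `^ p)) ?lerDr//.
    by rewrite -[leLHS]powRr1// ler_powR// ltW.
rewrite ge0_integralD//; last exact: measurable_funTS.
rewrite integral_cst// mul1e lte_add_pinfty//.
apply: le_lt_trans Ioo; apply: ge0_subset_integral => //.
Qed.

Lemma cube_integrable_loc f : locally_integrable_rV f -> cube_integrable f.
Proof.
move=> [mf iF]; split => // r.
pose K := [set x : 'rV[R]_n | forall i, `[- r, r]%classic (x ord0 i)].
apply: le_lt_trans (iF K (@compact_box R n (fun=> - r) (fun=> r))).
apply: ge0_subset_integral => //.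
- exact: measurable_cube.
- by apply: (measurable_box_rV (A := fun=> `[- r, r]%classic)).
- by apply: measurable_funTS; apply/measurable_EFinP; exact: measurableT_comp.
- by move=> x xr i; have := xr i; rewrite /= !in_itv/= => /andP[/ltW -> /ltW ->].
Qed.

Lemma cube_integrableZ c f : cube_integrable f -> cube_integrable (fun x => c * f x).
Proof.
move=> [mf iF]; split; first exact: measurable_funM.
move=> r; have mK : measurable (cube r : set 'rV[R]_n) by exact: measurable_cube.
have mnf : measurable_fun (cube r) (fun x => `|f x|%:E).
  by apply: measurable_funTS; apply/measurable_EFinP; exact: measurableT_comp.
under eq_integral do rewrite normrM EFinM.
by rewrite ge0_integralZl// lte_mul_pinfty.
Qed.

Lemma modulus_sum (p : \bar R) u (I : Type) (s : seq I) (w : I -> 'rV[R]_n) :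
  (1 <= p)%E -> measurable_fun setT u ->
  (modulus p u (\sum_(i <- s) w i)%R <= \sum_(i <- s) modulus p u (w i))%E.
Proof.
move=> p1 mu_; elim: s => [|i s IH]; first by rewrite !big_nil modulus0.
by rewrite !big_cons (le_trans (modulusD _ _ p1 mu_))// leeD2l.
Qed.

Lemma derive_flat_algZ phi c v x : flat_alg phi ->
  'D_v (cst c * phi) x = 'D_(c *: v) phi x.
Proof.
move=> F; have dphi := differentiable_flat_alg x F.
rewrite deriveM//; last exact: diff_derivable.
by rewrite derive_cst scaler0 addr0 !deriveE// linearZ.
Qed.

(** From x to x + y by the n steps y_i e_i; the step along e_i costs at most |y_i| times
the norm of the i-th weak derivative. *)
Lemma modulus_gradient (p : \bar R) u g y : (1 <= p)%E -> cube_integrable u ->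
  is_weak_gradient u g ->
  (modulus p u y <= (n%:R * eucl_norm y)%:E * 'N[mu]_p[(fun x => (eucl_norm (g x))%:E)])%E.
Proof.
move=> p1 iu wg; have mu_ := iu.1.
have mgi i : measurable_fun setT (fun x => g x ord0 i) by have [[]] := wg i.
have mg : measurable_fun setT (fun x => eucl_norm (g x)).
  by apply: (measurableT_comp (@measurable_eucl_norm R n)); exact: measurable_fun_rVP.
set N := ('N[mu]_p[_])%E.
have N0 : (0 <= N)%E by exact: Lnorm_ge0.
have one i : (modulus p u (y ord0 i *: base_vec i) <= (eucl_norm y)%:E * N)%E.
  set c := y ord0 i; pose G x := c * g x ord0 i.
  have mG : measurable_fun setT G by apply: measurable_funM.
  have [wgi1 wgi2] := wg i.
  have iG : cube_integrable G by apply: cube_integrableZ; exact: cube_integrable_loc.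
  have weak phi r : flat_alg phi -> (forall x, phi x != 0 -> cube r x) ->
      (\int[mu]_x (u x * 'D_(c *: base_vec i) phi x)%:E =
       - \int[mu]_x (G x * phi x)%:E)%E.
    move=> Fphi phir; have Fc : flat_alg (cst c * phi).
      by apply: flat_algM => //; exact: flat_alg_cst.
    have tc : test_function (cst c * phi).
      apply: (@test_function_flat_alg R n _ (fun=> - r) (fun=> r) Fc) => x.
      rewrite /= mulf_eq0 negb_or.
      by move=> /andP[_ /phir].
    have := wgi2 _ tc; under eq_integral do rewrite derive_flat_algZ//.
    move=> ->; congr (- _)%E; apply: eq_integral => x _.
    by rewrite /G /=; congr EFin; rewrite mulrCA mulrA.
  have H := shift_identity iu iG weak.
  apply: (@le_trans _ _ ('N[mu]_p[EFin \o G])%E).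
    case: p p1 @N N0 => [p p1|_|//] N N0; last exact: modulus_line_oo.
    by apply: modulus_line_fin.
  apply: (Lnorm_le_scale p1 (eucl_norm_ge0 _) mG mg) => x.
  rewrite /G normrM [X in _ <= _ * X](ger0_norm (eucl_norm_ge0 _)).
  by apply: ler_pM => //; exact: eucl_norm_coord.
rewrite [y in modulus p u y]row_sum_delta.
apply: (le_trans (modulus_sum _ _ p1 mu_)).
apply: (@le_trans _ _ (\sum_(i < n) ((eucl_norm y)%:E * N))%E).
  by apply: lee_sum => i _; exact: one.
have A0 : (0 <= (eucl_norm y)%:E * N)%E by rewrite mule_ge0// lee_fin eucl_norm_ge0.
have S m : (\sum_(i < m) ((eucl_norm y)%:E * N) = m%:R%:E * ((eucl_norm y)%:E * N))%E.
  elim: m => [|m IH]; first by rewrite big_ord0 mul0e.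
  by rewrite big_ord_recr/= IH -natr1 EFinD ge0_muleDl// mul1e.
by rewrite S muleA -EFinM.
Qed.

End gradient.

Theorem theorem1p1 (R : realType) (n : nat) (n1 : (1 <= n)%N) :
  (exists C : R, 0 < C /\ translation_estimate R n C) /\
  translation_estimate R n
    (4 * n%:R * (n%:R + 1) * expR (1 / (expR 1 * omega R n * n%:R))).
Proof.
set C := (X in translation_estimate R n X).
have om0 := @omega_gt0 R n.
have nR1 : (1 : R) <= n%:R by rewrite ler1n.
set E := expR _ in C *.
have E1 : 1 <= E.
  by rewrite -expR0 ler_expR divr_ge0// !mulr_ge0 ?expR_ge0// ltW.
(* The constants of the cases are 2, n, 3 and 4 (n + 1) E. *)
have CE : 4 * (n%:R + 1) * E <= C.
  rewrite /C ler_pM2r ?expR_gt0// ler_pM2r; last by lra.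
  by rewrite ler_peMr.
have C8 : 8 <= C.
  apply: le_trans CE; apply: (@le_trans _ _ (8 * E)).
    by rewrite ler_peMr.
  by rewrite ler_wpM2r ?expR_ge0//; lra.
have Cn : n%:R <= C.
  apply: le_trans CE; apply: (@le_trans _ _ (4 * (n%:R + 1))); first by lra.
  by rewrite ler_peMr//; lra.
have C0 : 0 < C by lra.
suff T : translation_estimate R n C by split => //; exists C.
move=> p s u y p1 /andP[s0 s1] [uL uoo].
have mu_ : measurable_fun setT u by move: uL => /andP[]; rewrite inE.
rewrite -/(modulus p u y).
have ys0 : (0 <= (eucl_norm y `^ s)%:E)%E by rewrite lee_fin powR_ge0.
have up (B : R) (Z : \bar R) : (0 <= Z)%E -> B <= C ->
    (modulus p u y <= B%:E * Z * (eucl_norm y `^ s)%:E)%E ->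
    (modulus p u y <= C%:E * Z * (eucl_norm y `^ s)%:E)%E.
  move=> Z0 BC /le_trans; apply; apply: lee_wpmul2r => //.
  by apply: lee_wpmul2r => //; rewrite lee_fin.
move: uoo; rewrite /sobolev_seminorm.
have [s00 _|sN0] := eqVneq s 0.
  apply: (up 2); [exact: Lnorm_ge0|by lra|].
  by rewrite s00 powRr0 mule1; exact: modulus_le2.
have [s11|sN1] := eqVneq s 1.
  rewrite /gradient_norm; case: asboolP => // wg _.
  apply: (up n%:R) => //; first exact: Lnorm_ge0.
  rewrite s11 powRr1 ?eucl_norm_ge0// muleAC -EFinM.
  apply: modulus_gradient => //; first exact: cube_integrable_Lfun uL.
  exact: (xgetPex (cst 0) wg).
have s01 : 0 < s < 1 by rewrite !lt_neqAle eq_sym sN0 sN1 s0 s1.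
case: p p1 uL up => [p p1 uL up _|_ uL up uoo|//].
  apply: (up _ _ _ CE); first exact: poweR_ge0.
  by apply: modulus_gagliardo.
apply: (up 3); [exact: hoelder_esssup_ge0|by lra|exact: modulus_hoelder].
Qed.
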